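(* There is a linear time algorithm for the Weighted Barycenter Recognition problem restricted to cubic graphs: there is an algorithm which, given a straight-line planar drawing $\Gamma$ of a triconnected cubic plane graph $G=(V,E)$ with $n$ vertices (specified by the position $\gamma_i\in\mathbb{R}^2$ of each vertex $i$) such that the vertices on the convex hull of $\{\gamma_i : i\in V\}$ form a face of $G$, decides using $O(n)$ operations whether $\Gamma$ is a weighted barycenter drawing.
   Context: The face formed by the vertices on the convex hull of $\{\gamma_i : i\in V\}$ is the outer face $F_0$. A vertex is external if it lies on $F_0$ and internal otherwise. An edge is internal if it is incident to at least one internal vertex. $N(i)$ is the set of neighbours of $i$. The drawing $\Gamma$ is a weighted barycenter drawing if there is a real weight $w_{ij}=w_{ji}>0$ for each internal edge $(i,j)$ such that for each internal vertex $i$ $$\gamma_i=\frac{1}{\sum_{j\in N(i)} w_{ij}}\sum_{j\in N(i)} w_{ij}\gamma_j .$$ Running time is measured in the number of elementary steps, where each arithmetic operation and comparison on real numbers counts as one step. *)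

(* Defs.v *)
From HB Require Import structures.
From mathcomp Require Import all_boot all_order all_algebra.
From mathcomp Require Import classical_sets reals topology normedtype trigo.

Set Implicit Arguments.
Unset Strict Implicit.
Unset Printing Implicit Defensive.

Import Order.TTheory GRing.Theory Num.Theory.
Import numFieldNormedType.Exports.

Local Open Scope classical_set_scope.
Local Open Scope ring_scope.

(* A plane graph on the vertices 0, ..., n-1, given by its combinatorial
   embedding: [rot G i] lists the neighbours of [i] in counterclockwise order
   around [i], starting anywhere.  That the rotation system is planar is not a
   field: it is imposed by [straight_line_planar_drawing] below. *)
Record plane_graph (n : nat) := PlaneGraph {
  rot : 'I_n -> seq 'I_n;
  rot_uniq : forall i, uniq (rot i);
  rot_irrefl : forall i, i \notin rot i;
  rot_sym : forall i j, (j \in rot i) = (i \in rot j)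
}.

Section Graph.
Context (n : nat) (G : plane_graph n).

Definition adj : rel 'I_n := fun i j => j \in rot G i.

Definition cubic : Prop := forall i, size (rot G i) = 3%N.

Definition triconnected : Prop :=
  (3 < n)%N /\
  forall S : {set 'I_n}, (#|S| < 3)%N ->
  forall i j, i \notin S -> j \notin S ->
  connect [rel x y | [&& x \notin S, y \notin S & adj x y]] i j.

(* Faces are the orbits, on the darts (i, j) with [adj i j], of the map sending
   (i, j) to (j, k), where k follows i in the rotation at j. *)
Definition face_next (d : 'I_n * 'I_n) : 'I_n * 'I_n :=
  (d.2, next (rot G d.2) d.1).

Definition face_vertices (d : 'I_n * 'I_n) : {set 'I_n} :=
  [set e.1 | e in orbit face_next d]%SET.

End Graph.

Section Drawing.
Context (R : realType) (n : nat) (G : plane_graph n) (g : 'I_n -> 'rV[R]_2).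

Definition segment (p q : 'rV[R]_2) : set 'rV[R]_2 :=
  [set x | exists2 t : R, 0 <= t <= 1 & x = (1 - t) *: p + t *: q].

(* The directions of the edges leaving [i] have arguments [theta j] that
   increase along [rot G i] and span less than a full turn. *)
Definition ccw_rotation_at (i : 'I_n) : Prop :=
  exists theta : 'I_n -> R,
    [/\ forall j, j \in rot G i -> exists2 r : R, 0 < r &
          (g j - g i) 0 0 = r * cos (theta j) /\
          (g j - g i) 0 1 = r * sin (theta j),
        sorted <%R [seq theta j | j <- rot G i]
      & forall j k, j \in rot G i -> k \in rot G i ->
          theta k - theta j < 2 * pi].

(* A straight-line drawing without crossings, inducing the embedding of [G]. *)
Definition straight_line_planar_drawing : Prop :=
  [/\ injective g,
      forall i j k, adj G i j -> segment (g i) (g j) (g k) -> k = i \/ k = j,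
      forall i j k l, adj G i j -> adj G k l -> [set i; j]%SET != [set k; l]%SET ->
        forall x, segment (g i) (g j) x -> segment (g k) (g l) x ->
        exists2 v, v \in ([set i; j] :&: [set k; l])%SET & x = g v
    & forall i, ccw_rotation_at i].

Definition convex_hull : set 'rV[R]_2 :=
  [set x | exists lam : 'I_n -> R,
     [/\ forall i, 0 <= lam i, \sum_i lam i = 1 & x = \sum_i lam i *: g i]].

(* "On the convex hull" means on its boundary; the vertex need not be an
   extreme point. *)
Definition on_hull (i : 'I_n) : Prop :=
  (closure convex_hull `\` interior convex_hull) (g i).

Definition hull_vertices_form_face : Prop :=
  exists d : 'I_n * 'I_n, adj G d.1 d.2 /\
    forall i, i \in face_vertices G d <-> on_hull i.

(* The outer face is the face whose vertices are those on the hull. *)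
Definition external (i : 'I_n) : Prop := on_hull i.
Definition internal (i : 'I_n) : Prop := ~ external i.

Definition internal_edge (i j : 'I_n) : Prop :=
  adj G i j /\ (internal i \/ internal j).

Definition weighted_barycenter_drawing : Prop :=
  exists w : 'I_n -> 'I_n -> R,
    (forall i j, internal_edge i j -> w i j = w j i /\ 0 < w i j) /\
    (forall i, internal i ->
       g i = (\sum_(j | adj G i j) w i j)^-1 *:
             \sum_(j | adj G i j) w i j *: g j).

End Drawing.

(* A real RAM, as a structured programming language.  A state consists of
   registers and unbounded arrays holding natural numbers or real numbers; a
   program names finitely many of them, array cells being addressed by computed
   indices.  There is no conversion between the two sorts, the only constants
   are natural numerals, and natural numbers are only added and subtracted. *)

Inductive iexp :=
| ICst of nat
| IReg of nat
| IGet of nat & iexp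
| IAdd of iexp & iexp
| ISub of iexp & iexp.

Inductive rexp :=
| RCst of nat
| RReg of nat
| RGet of nat & iexp
| RAdd of rexp & rexp
| RSub of rexp & rexp
| RMul of rexp & rexp
| RDiv of rexp & rexp.

Inductive bexp :=
| ILe of iexp & iexp
| IEq of iexp & iexp
| RLe of rexp & rexp
| REq of rexp & rexp
| BNot of bexp
| BAnd of bexp & bexp.

Inductive prog :=
| Skip
| ISet of nat & iexp
| IPut of nat & iexp & iexp
| RSet of nat & rexp
| RPut of nat & iexp & rexp
| Seq of prog & prog
| If of bexp & prog & prog
| While of bexp & prog.

Record state (R : Type) := State {
  ireg : nat -> nat;
  rreg : nat -> R;
  iarr : nat -> nat -> nat;
  rarr : nat -> nat -> R
}.

Definition upd (T : Type) (f : nat -> T) (a : nat) (v : T) : nat -> T :=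
  fun b => if b == a then v else f b.

(* Every constant, register or array access, arithmetic operation, comparison
   and connective costs one step. *)
Fixpoint icost (e : iexp) : nat :=
  match e with
  | ICst _ | IReg _ => 1
  | IGet _ e1 => (icost e1).+1
  | IAdd e1 e2 | ISub e1 e2 => (icost e1 + icost e2).+1
  end.

Fixpoint rcost (e : rexp) : nat :=
  match e with
  | RCst _ | RReg _ => 1
  | RGet _ e1 => (icost e1).+1
  | RAdd e1 e2 | RSub e1 e2 | RMul e1 e2 | RDiv e1 e2 =>
      (rcost e1 + rcost e2).+1
  end.

Fixpoint bcost (b : bexp) : nat :=
  match b with
  | ILe e1 e2 | IEq e1 e2 => (icost e1 + icost e2).+1
  | RLe e1 e2 | REq e1 e2 => (rcost e1 + rcost e2).+1
  | BNot b1 => (bcost b1).+1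
  | BAnd b1 b2 => (bcost b1 + bcost b2).+1
  end.

Section Semantics.
Context (R : realType).
Implicit Type s : state R.

(* Subtraction of natural numbers is truncated. *)
Fixpoint ieval s (e : iexp) : nat :=
  match e with
  | ICst k => k
  | IReg x => ireg s x
  | IGet a e1 => iarr s a (ieval s e1)
  | IAdd e1 e2 => (ieval s e1 + ieval s e2)%N
  | ISub e1 e2 => (ieval s e1 - ieval s e2)%N
  end.

(* Division by 0 yields 0. *)
Fixpoint reval s (e : rexp) : R :=
  match e with
  | RCst k => k%:R
  | RReg x => rreg s x
  | RGet a e1 => rarr s a (ieval s e1)
  | RAdd e1 e2 => reval s e1 + reval s e2
  | RSub e1 e2 => reval s e1 - reval s e2
  | RMul e1 e2 => reval s e1 * reval s e2
  | RDiv e1 e2 => reval s e1 / reval s e2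
  end.

Fixpoint beval s (b : bexp) : bool :=
  match b with
  | ILe e1 e2 => (ieval s e1 <= ieval s e2)%N
  | IEq e1 e2 => ieval s e1 == ieval s e2
  | RLe e1 e2 => reval s e1 <= reval s e2
  | REq e1 e2 => reval s e1 == reval s e2
  | BNot b1 => ~~ beval s b1
  | BAnd b1 b2 => beval s b1 && beval s b2
  end.

Definition set_ireg s x v := State (upd (ireg s) x v) (rreg s) (iarr s) (rarr s).
Definition set_rreg s x v := State (ireg s) (upd (rreg s) x v) (iarr s) (rarr s).
Definition set_iarr s a k v :=
  State (ireg s) (rreg s) (upd (iarr s) a (upd (iarr s a) k v)) (rarr s).
Definition set_rarr s a k v :=
  State (ireg s) (rreg s) (iarr s) (upd (rarr s) a (upd (rarr s a) k v)).

(* [exec p s t s']: started in [s], [p] halts in [s'] after [t] steps. *)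
Inductive exec : prog -> state R -> nat -> state R -> Prop :=
| exec_Skip s : exec Skip s 1 s
| exec_ISet s x e :
    exec (ISet x e) s (icost e).+1 (set_ireg s x (ieval s e))
| exec_IPut s a e1 e2 :
    exec (IPut a e1 e2) s (icost e1 + icost e2).+1
         (set_iarr s a (ieval s e1) (ieval s e2))
| exec_RSet s x e :
    exec (RSet x e) s (rcost e).+1 (set_rreg s x (reval s e))
| exec_RPut s a e1 e2 :
    exec (RPut a e1 e2) s (icost e1 + rcost e2).+1
         (set_rarr s a (ieval s e1) (reval s e2))
| exec_Seq p1 p2 s s1 s2 t1 t2 :
    exec p1 s t1 s1 -> exec p2 s1 t2 s2 ->
    exec (Seq p1 p2) s (t1 + t2) s2
| exec_IfTrue b p1 p2 s s' t :
    beval s b -> exec p1 s t s' ->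
    exec (If b p1 p2) s (bcost b + t).+1 s'
| exec_IfFalse b p1 p2 s s' t :
    ~~ beval s b -> exec p2 s t s' ->
    exec (If b p1 p2) s (bcost b + t).+1 s'
| exec_WhileTrue b p s s1 s2 t1 t2 :
    beval s b -> exec p s t1 s1 -> exec (While b p) s1 t2 s2 ->
    exec (While b p) s (bcost b + t1 + t2).+1 s2
| exec_WhileFalse b p s :
    ~~ beval s b -> exec (While b p) s (bcost b).+1 s.

End Semantics.

(* Input: register 0 holds n; cell v of integer array k holds the k-th entry of
   the rotation at v; cell v of real arrays 0 and 1 holds the coordinates of the
   position of v.  Everything else is 0. *)
Definition input (R : realType) (n : nat) (G : plane_graph n)
    (g : 'I_n -> 'rV[R]_2) : state R :=
  {| ireg := fun x => if x == 0%N then n else 0%N;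
     rreg := fun=> 0;
     iarr := fun k v =>
       if insub v is Some i then nth 0%N [seq val j | j <- rot G i] k else 0%N;
     rarr := fun a v =>
       if insub v is Some i then
         if a == 0%N then g i 0 0 else if a == 1%N then g i 0 1 else 0
       else 0 |}.

(* Output: the answer is "yes" iff integer register 0 finally holds 1. *)
Definition answers_yes (R : realType) (s : state R) : Prop := ireg s 0 = 1%N.

(* Main.v *)
From mathcomp Require Import all_boot all_order all_algebra reals.
From mathcomp Require Import boolp classical_sets topology normedtype.
From mathcomp Require Import ring lra zify.
Require Import Defs.

(* At an internal vertex the three edge vectors of a planar drawing are not
   parallel, so the barycentric coordinates of the vertex with respect to its
   neighbours are unique.  The weights are therefore determined up to one
   positive scale per internal vertex, and the scales of two adjacent internal
   vertices determine each other: a search of the internal vertices computes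
   them, and it remains to test all edges.

   To find the outer face in linear time, start from a leftmost vertex [v].  An
   edge between two hull vertices has all vertices on one side of its line:
   otherwise an edge of the graph without these two vertices, which is
   connected, would cross that line, either inside the edge or at a point
   showing that one end of the edge is interior to the hull.  Of the three
   edges at [v] at least one is not of this kind, so the other two are
   consecutive on the outer face. *)

Set Implicit Arguments.
Unset Strict Implicit.
Unset Printing Implicit Defensive.

Import Order.TTheory GRing.Theory Num.Theory.
Import numFieldNormedType.Exports.

(** * Loop programs and their cost *)

Fixpoint loop_free (p : prog) : bool :=
  match p with
  | Seq p1 p2 | If _ p1 p2 => loop_free p1 && loop_free p2
  | While _ _ => false
  | _ => true
  end.

(* Loops are charged for the at most [3 n] iterations of [For] below. *)
Fixpoint cost_factor (p : prog) : nat :=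
  match p with
  | Skip => 1
  | ISet _ e => (icost e).+1
  | IPut _ e1 e2 => (icost e1 + icost e2).+1
  | RSet _ e => (rcost e).+1
  | RPut _ e1 e2 => (icost e1 + rcost e2).+1
  | Seq p1 p2 => cost_factor p1 + cost_factor p2
  | If b p1 p2 => (bcost b + (cost_factor p1 + cost_factor p2)).+1
  | While b p1 => 3 * (bcost b + cost_factor p1).+1 + (bcost b).+1
  end.

(** Index expressions have no product, so [m * n] is spelled out as a sum of copies of register
    0. *)
Fixpoint times_n (m : nat) : iexp :=
  if m is m'.+1 then IAdd (IReg 0) (times_n m') else ICst 0.

Definition For (m : nat) (p : prog) : prog :=
  Seq (ISet 1 (ICst 0))
      (While (ILe (IAdd (IReg 1) (ICst 1)) (times_n m))
             (Seq p (ISet 1 (IAdd (IReg 1) (ICst 1))))).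

Notation "p ;; q" := (Seq p q) (at level 60, right associativity).

Section Semantics.
Context {R : realType}.
Implicit Types (s : state R) (p : prog).

(** A functional semantics for loop-free programs only; the value at [While] is a dummy. *)
Fixpoint run p s : state R :=
  match p with
  | Skip | While _ _ => s
  | ISet x e => set_ireg s x (ieval s e)
  | IPut a e1 e2 => set_iarr s a (ieval s e1) (ieval s e2)
  | RSet x e => set_rreg s x (reval s e)
  | RPut a e1 e2 => set_rarr s a (ieval s e1) (reval s e2)
  | Seq p1 p2 => run p2 (run p1 s)
  | If b p1 p2 => if beval s b then run p1 s else run p2 s
  end.

Lemma loop_free_exec p s :
  loop_free p -> exists2 t, t <= cost_factor p & exec p s t (run p s).
Proof.
elim: p s => [|x e|a e1 e2|x e|a e1 e2|p1 IH1 p2 IH2|b p1 IH1 p2 IH2|//] s /=.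
- by eexists; last exact: exec_Skip.
- by eexists; last exact: exec_ISet.
- by eexists; last exact: exec_IPut.
- by eexists; last exact: exec_RSet.
- by eexists; last exact: exec_RPut.
- move=> /andP[/IH1 h1 /IH2 h2]; have [t1 l1 e1] := h1 s.
  have [t2 l2 e2] := h2 (run p1 s).
  by eexists; last exact: exec_Seq e1 e2; exact: leq_add.
- move=> /andP[/IH1 h1 /IH2 h2]; case: (boolP (beval s b)) => hb.
    have [t1 l1 e1] := h1 s.
    by eexists; last exact: exec_IfTrue hb e1; lia.
  have [t2 l2 e2] := h2 s.
  by eexists; last exact: exec_IfFalse hb e2; lia.
Qed.

(** Total correctness with a time bound. The factor of [n] depends on the program text alone, so
    that sequencing adds the factors and the final constant is uniform. *)
Definition triple (n : nat) (P : state R -> Prop) p (Q : state R -> Prop) :=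
  forall s, P s -> exists t s', [/\ exec p s t s', t <= cost_factor p * n & Q s'].

Lemma triple_seq n P Q S p1 p2 :
  triple n P p1 Q -> triple n Q p2 S -> triple n P (Seq p1 p2) S.
Proof.
move=> h1 h2 s /h1[t1 [s1 [e1 l1 /h2[t2 [s2 [e2 l2 Ss]]]]]].
exists (t1 + t2), s2; split => //; first exact: exec_Seq e1 e2.
by rewrite mulnDl leq_add.
Qed.

Lemma triple_loop_free n (P Q : state R -> Prop) p :
  0 < n -> loop_free p -> (forall s, P s -> Q (run p s)) -> triple n P p Q.
Proof.
move=> n0 lp h s /h Qs; have [t lt e] := loop_free_exec s lp.
by exists t, (run p s); split => //; rewrite (leq_trans lt) // leq_pmulr.
Qed.

Lemma ieval_times_n s m : ieval s (times_n m) = m * ireg s 0.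
Proof. by elim: m => [//|m /= ->]; rewrite mulSn. Qed.

(** The invariant has to be insensitive to register 1, which the loop itself overwrites; [m <= 3]
    matches the charge made by [cost_factor]. *)
Lemma triple_for n (J : nat -> state R -> Prop) m p :
  0 < n -> m <= 3 -> loop_free p ->
  (forall k s, J k s -> ireg s 0 = n) ->
  (forall k s x, J k s -> J k (set_ireg s 1 x)) ->
  (forall k s, k < m * n -> ireg s 1 = k -> J k s ->
     ireg (run p s) 1 = k /\ J k.+1 (run p s)) ->
  triple n (J 0) (For m p) (J (m * n)).
Proof.
move=> n0 m3 lp Jn J1 Jstep s J0.
pose body := Seq p (ISet 1 (IAdd (IReg 1) (ICst 1))).
pose c := cost_factor body; pose b := bcost (ILe (IAdd (IReg 1) (ICst 1)) (times_n m)).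
(* Induction on the number [d] of rounds left; the summand [b.+1] pays for the last, failing
   test. *)
have loop d : forall k s1, k + d = m * n -> ireg s1 1 = k -> J k s1 ->
  exists t s', [/\ exec (While (ILe (IAdd (IReg 1) (ICst 1)) (times_n m)) body) s1 t s',
    t <= d * (b + c).+1 + b.+1 & J (m * n) s'].
  elim: d => [|d IH] k s1 kd sk Jk.
    exists b.+1, s1; split; last by rewrite -kd addn0.
      by apply: exec_WhileFalse; rewrite /= ieval_times_n (Jn _ _ Jk) sk; lia.
    by rewrite mul0n.
  have [|sk' Jk'] := Jstep k s1 _ sk Jk; first by lia.
  have [|t1 l1 e1] := @loop_free_exec body s1; first by rewrite /= lp.
  have [|||t2 [s2 [e2 l2 Js2]]] := IH k.+1 (run body s1).
  - by lia.
  - by rewrite /= /upd /= sk' addn1.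
  - exact: J1.
  exists (b + t1 + t2).+1, s2; split => //.
    apply: exec_WhileTrue e1 e2.
    by rewrite /= ieval_times_n (Jn _ _ Jk) sk; lia.
  by move: l1 l2; rewrite -/c mulSn; clearbody b c; lia.
have [t [s' [e l Js']]] := loop (m * n) 0 (set_ireg s 1 0) erefl erefl (J1 _ _ _ J0).
exists (2 + t), s'; split=> //.
  exact: exec_Seq (exec_ISet s 1 (ICst 0)) e.
rewrite (_ : cost_factor (For m p) = 2 + (3 * (b + c).+1 + b.+1)) //.
have : m * n * (b + c).+1 <= 3 * n * (b + c).+1 by rewrite !leq_mul2r m3 !orbT.
have : b.+1 <= b.+1 * n by rewrite leq_pmulr.
move: l; rewrite !mulnDl (mulnAC 3); clearbody b c; lia.
Qed.

Lemma triple_conseq n (P P' Q Q' : state R -> Prop) p :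
  (forall s, P s -> P' s) -> (forall s, Q' s -> Q s) ->
  triple n P' p Q' -> triple n P p Q.
Proof.
move=> hP hQ h s /hP/h[t [s' [e l /hQ Qs']]].
by exists t, s'.
Qed.

(** Lets a witness found by one stage serve as a fixed parameter in the analysis of the next. *)
Lemma triple_exists n (T : Type) (P : T -> state R -> Prop) p Q :
  (forall x, triple n (P x) p Q) -> triple n (fun s => exists x, P x s) p Q.
Proof. by move=> h s [x /h]. Qed.

End Semantics.

Local Open Scope ring_scope.

(** * Plane geometry *)

Section PlaneVectors.
Context {R : realType}.
Implicit Types (u v w : 'rV[R]_2) (C : set 'rV[R]_2).

Definition cross u v := u 0 0 * v 0 1 - u 0 1 * v 0 0.
Definition dot u v := u 0 0 * v 0 0 + u 0 1 * v 0 1.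

Lemma rowv2P u v : u 0 0 = v 0 0 -> u 0 1 = v 0 1 -> u = v.
Proof.
move=> e0 e1; apply/rowP => i; case: i => [[|[|//]] ilt].
- by rewrite (_ : Ordinal ilt = 0) //; apply/val_inj.
- by rewrite (_ : Ordinal ilt = 1) //; apply/val_inj.
Qed.

(** Cramer's rule: the explicit linear dependence of three plane vectors. For the edge vectors at a
    vertex its normalised coefficients are the barycentric coordinates. *)
Lemma cross_relation u v w : cross v w *: u + cross w u *: v + cross u v *: w = 0.
Proof. by apply: rowv2P; rewrite !mxE /cross; ring. Qed.

Lemma dot_gt0 u : u != 0 -> 0 < dot u u.
Proof.
move=> u0; rewrite lt_def; apply/andP; split; last by rewrite /dot; nra.
apply: contra u0 => /eqP d0; apply/eqP.
have h0 : u 0 0 = 0 by move: d0; rewrite /dot; nra.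
have h1 : u 0 1 = 0 by move: d0; rewrite /dot h0; nra.
by apply: rowv2P; rewrite mxE.
Qed.

(** A vector parallel to [u] equals its orthogonal projection onto [u]. *)
Lemma parallel_coef u v : u != 0 -> cross u v = 0 -> v = (dot u v / dot u u) *: u.
Proof.
move=> u0 c0; have := dot_gt0 u0; rewrite lt0r => /andP[d0 _].
apply: rowv2P; rewrite mxE; apply: (mulIf d0); rewrite mulrAC divfK //.
  have -> : dot u v * u 0 0 = v 0 0 * dot u u + u 0 1 * cross u v
    by rewrite /dot /cross; ring.
  by rewrite c0 mulr0 addr0.
have -> : dot u v * u 0 1 = v 0 1 * dot u u - u 0 0 * cross u v
  by rewrite /dot /cross; ring.
by rewrite c0 mulr0 subr0.
Qed.

(* Every [y] near [z] on the side of [P] is a convex combination of [P] and of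
   a point between [z - a e] and [z + b e]; the bounds on its coefficients are
   strict at [y = z]. *)
Lemma interior_of_cross C (z e P Q : 'rV[R]_2) (a b : R) :
  (forall x y (t : R), 0 <= t <= 1 -> C x -> C y -> C ((1 - t) *: x + t *: y)) ->
  0 < a -> 0 < b -> C (z - a *: e) -> C (z + b *: e) -> C P -> C Q ->
  0 < cross e (P - z) -> cross e (Q - z) < 0 -> interior C z.
Proof.
move=> convC a0 b0 Ca Cb CP CQ hP hQ.
have e0 : e != 0.
  by apply: contraTneq hP => ->; rewrite /cross !mxE !mul0r subrr ltxx.
have ee := dot_gt0 e0.
have line t : - a <= t <= b -> C (z + t *: e).
  move=> /andP[ta tb]; have ab : 0 < a + b by lra.
  have abn : a + b != 0 by lra.
  have -> : z + t *: e = (1 - (t + a) / (a + b)) *: (z - a *: e)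
                         + ((t + a) / (a + b)) *: (z + b *: e).
    by apply: rowv2P; rewrite !mxE; field.
  apply: convC => //; apply/andP; split; first by apply: divr_ge0; lra.
  by rewrite ler_pdivrMr //; lra.
(* [l] and [nu] are the coordinates of [y - z] along [W - z] and [e]. Both vanish at [y = z] and are
   continuous, so the strict bounds required by [step] persist near [z]. *)
pose l (y W : 'rV[R]_2) : R := cross e (y - z) / cross e (W - z).
pose nu (y W : 'rV[R]_2) : R := dot e (y - z - l y W *: (W - z)) / dot e e.
have step y W : C W -> cross e (W - z) != 0 -> 0 <= l y W -> l y W < 1 ->
    - a * (1 - l y W) < nu y W -> nu y W < b * (1 - l y W) -> C y.
  move=> CW W0 l0 l1 n1 n2.
  have -> : y = (1 - l y W) *: (z + (nu y W / (1 - l y W)) *: e) + l y W *: W.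
    have : y - z - l y W *: (W - z) = nu y W *: e.
      apply: parallel_coef => //; rewrite /l.
      have -> : cross e (y - z - cross e (y - z) / cross e (W - z) *: (W - z))
        = cross e (y - z) - cross e (y - z) / cross e (W - z) * cross e (W - z).
        by rewrite /cross !mxE; ring.
      by rewrite divfK // subrr.
    move/matrixP => h; have {h}[h0 h1] := (h 0 0, h 0 1).
    have l1' : 1 - l y W != 0 by lra.
    move: h0 h1; rewrite !mxE => h0 h1.
    apply: rowv2P; rewrite !mxE mulrDr mulrA (mulrCA (1 - _)) divff // mulr1; lra.
  apply: convC => //; first by rewrite l0 ltW.
  apply: line; have l1' : 0 < 1 - l y W by lra.
  by rewrite ler_pdivlMr // ler_pdivrMr //; apply/andP; split; lra.
have near_step (F : set_system 'rV[R]_2) W : Filter F ->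
    (forall i, ((y : 'rV[R]_2) 0 i @[y --> F] --> z 0 i)%classic) ->
    \forall y \near F, [/\ l y W < 1,
      - a * (1 - l y W) < nu y W & nu y W < b * (1 - l y W)].
  move=> FF cc.
  have lz : l z W = 0 by rewrite /l subrr /cross !mxE !mulr0 subrr mul0r.
  have nz : nu z W = 0
    by rewrite /nu lz scale0r subrr subr0 /dot !mxE !mulr0 addr0 mul0r.
  have contl : (l y W @[y --> F] --> l z W)%classic.
    apply: cvgM; last exact: cvg_cst.
    rewrite /cross; under eq_fun do rewrite !mxE; rewrite !mxE.
    by apply: cvgB; (apply: cvgM; first exact: cvg_cst); apply: cvgB;
      try exact: cvg_cst; exact: cc.
  have contn : (nu y W @[y --> F] --> nu z W)%classic.
    apply: cvgM; last exact: cvg_cst.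
    rewrite /dot; under eq_fun do rewrite !mxE; rewrite !mxE.
    by apply: cvgD; (apply: cvgM; first exact: cvg_cst); apply: cvgB;
      [ apply: cvgB; [exact: cc | exact: cvg_cst]
      | apply: cvgM; [exact: contl | exact: cvg_cst]
      | apply: cvgB; [exact: cc | exact: cvg_cst]
      | apply: cvgM; [exact: contl | exact: cvg_cst] ].
  have cont1 c : (c * (1 - l y W) @[y --> F] --> c * (1 - l z W))%classic.
    by apply: cvgM; [|apply: cvgB]; [exact: cvg_cst..|exact: contl].
  have h1 := cvgB contn (cont1 (- a)); have h2 := cvgB (cont1 b) contn.
  near=> y; split; near: y.
  - by apply: (cvgr_lt _ contl); rewrite lz.
  - near=> y; rewrite -subr_gt0; near: y.
    by apply: (cvgr_gt _ (h1 FF)); rewrite lz nz; lra.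
  - near=> y; rewrite -subr_gt0; near: y.
    by apply: (cvgr_gt _ (h2 FF)); rewrite lz nz; lra.
rewrite /interior; near=> y.
(* The apex is taken on the side of [y], which makes its coefficient [l] nonnegative. *)
case: (leP 0 (cross e (y - z))) => [h|h].
- have [l1 n1 n2] : [/\ l y P < 1,
    - a * (1 - l y P) < nu y P & nu y P < b * (1 - l y P)]
    by near: y; apply: near_step => i; exact: coord_continuous.
  apply: (step y P) => //; first by rewrite gt_eqF.
  by apply: divr_ge0 => //; exact: ltW.
- have [l1 n1 n2] : [/\ l y Q < 1,
    - a * (1 - l y Q) < nu y Q & nu y Q < b * (1 - l y Q)]
    by near: y; apply: near_step => i; exact: coord_continuous.
  apply: (step y Q) => //; first by rewrite lt_eqF.
  by rewrite /l -[_ / _]opprK -mulrN -invrN -mulNr; apply: divr_ge0; lra.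
Unshelve. all: end_near.
Qed.

End PlaneVectors.

(** A discrete intermediate value theorem: take the first edge of the path that leaves [P]. *)
Lemma connect_crossing (T : finType) (e : rel T) (P : pred T) x y :
  connect e x y -> P x -> ~~ P y -> exists u v, [/\ e u v, P u & ~~ P v].
Proof.
move=> /connectP[s es ->] {y}; elim: s x es => [|z s IH] x /=; first by move=> _ ->.
move=> /andP[exz es] Px nPl; case: (boolP (P z)) => Pz; first exact: IH es Pz nPl.
by exists x, z.
Qed.

(** * Convex hull of the vertices and sides of a line *)

Section ConvexHull.
Context {R : realType} {n : nat} (g : 'I_n -> 'rV[R]_2).

Lemma convex_hull_convex x y (t : R) : 0 <= t <= 1 ->
  convex_hull g x -> convex_hull g y -> convex_hull g ((1 - t) *: x + t *: y).
Proof.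
move=> /andP[t0 t1] [l [l0 l1 ->]] [m [m0 m1 ->]].
exists (fun i => (1 - t) * l i + t * m i); split.
- by move=> i; apply: addr_ge0; apply: mulr_ge0 => //; lra.
- by rewrite big_split /= -!mulr_sumr l1 m1; lra.
- rewrite !scaler_sumr -big_split /=; apply: eq_bigr => i _.
  by rewrite [RHS]scalerDl !scalerA.
Qed.

Lemma convex_hull_vertex i : convex_hull g (g i).
Proof.
exists (fun j => (j == i)%:R); split.
- by move=> j; rewrite ler0n.
- by rewrite (bigD1 i) //= eqxx big1 ?addr0 // => j /negbTE ->.
- by rewrite (bigD1 i) //= eqxx scale1r big1 ?addr0 // => j /negbTE ->; rewrite scale0r.
Qed.

(** Abscissas in the hull are averages of abscissas of vertices, so every ball around [g i] contains
    a point, shifted to the left, outside the hull. *)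
Lemma on_hull_leftmost i : (forall j, g i 0 0 <= g j 0 0) -> on_hull g i.
Proof.
move=> left_i; split; first exact/subset_closure/convex_hull_vertex.
rewrite /interior => /nbhs_ballP[e /= e0 hb].
have : convex_hull g (g i - (e / 2) *: const_mx 1).
  apply: hb; split=> // a b; rewrite !mxE mulr1 /ball /=.
  by rewrite opprB addrC subrK ger0_norm; lra.
case=> l [l0 l1 /matrixP/(_ 0 0)]; rewrite summxE !mxE mulr1.
suff : g i 0 0 <= \sum_j (l j *: g j) 0 0 by lra.
rewrite -[leLHS]mul1r -l1 mulr_suml; apply: ler_sum => j _.
by rewrite mxE ler_wpM2l.
Qed.

(** Twice the signed area of the triangle: positive when [k] is to the left of the line directed
    from [i] to [j]. *)
Definition side (i j k : 'I_n) : R := cross (g j - g i) (g k - g i).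

Definition one_sided (i j : 'I_n) : bool :=
  ~~ ([exists p, 0 < side i j p] && [exists q, side i j q < 0]).

(** Otherwise [g i] lies strictly between the hull points [x] and [g j], with hull points strictly
    on both sides of their line, and is interior. *)
Lemma on_hull_not_crossed i j p q x (b : R) :
  on_hull g i -> 0 < side i j p -> side i j q < 0 -> convex_hull g x ->
  x = g i - b *: (g j - g i) -> 0 < b -> False.
Proof.
move=> [_ ni] hp hq Cx ex b0; apply: ni.
apply: (@interior_of_cross _ _ _ (g j - g i) (g p) (g q) b 1) => //.
- exact: convex_hull_convex.
- by rewrite -ex.
- by rewrite scale1r addrC subrK; exact: convex_hull_vertex.
- exact: convex_hull_vertex.
- exact: convex_hull_vertex.
Qed.

End ConvexHull.

(** * Directions of the edges at a vertex of a planar drawing *)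

Section PlanarDrawing.
Context {R : realType} {n : nat} (G : plane_graph n) (g : 'I_n -> 'rV[R]_2).
Context (G3 : triconnected G).
Context (Gplanar : straight_line_planar_drawing G g).

Lemma hull_edge_one_sided i j :
  adj G i j -> on_hull g i -> on_hull g j -> one_sided g i j.
Proof.
move=> aij hi hj; apply/negP => /andP[/existsP[p hp] /existsP[q hq]].
have sii : side g i j i = 0 by rewrite /side subrr /cross !mxE !mulr0 subrr.
have sij : side g i j j = 0 by rewrite /side /cross; ring.
have notS k : side g i j k != 0 -> k \notin [set i; j]%SET.
  by rewrite !inE => h; apply/norP; split; apply: contraNneq h => ->; rewrite ?sii ?sij.
have pS := notS p (lt0r_neq0 hp); have qS := notS q (ltr0_neq0 hq).
have cS : (#|[set i; j]%SET| < 3)%N by rewrite cards2; case: (i != j).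
have [_ /(_ _ cS _ _ pS qS) cpq] := G3.
(* A path from [p] to [q] avoiding [i] and [j] exists by triconnectivity; one of its edges leaves
   the positive side of the line. *)
have [||k [l [/and3P[kS lS akl] sk]]] :=
  @connect_crossing _ _ [pred k | 0 < side g i j k] _ _ cpq.
- by rewrite /= hp.
- by rewrite /= -leNgt ltW.
rewrite /= -leNgt in sk * => sl.
(* The side is affine along the edge from [k] to [l] and vanishes at parameter [t]. *)
pose t := side g i j k / (side g i j k - side g i j l).
have t01 : 0 <= t <= 1.
  apply/andP; split; first by apply: divr_ge0; lra.
  by rewrite ler_pdivrMr ?mul1r; lra.
pose x := (1 - t) *: g k + t *: g l.
have Cx : convex_hull g x by apply: convex_hull_convex => //; exact: convex_hull_vertex.
have e0 : g j - g i != 0.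
  by apply: contraTneq hp; rewrite /side => ->; rewrite /cross !mxE !mul0r subrr ltxx.
pose m := dot (g j - g i) (x - g i) / dot (g j - g i) (g j - g i).
have xE : x - g i = m *: (g j - g i).
  apply: parallel_coef => //.
  have -> : cross (g j - g i) (x - g i) = side g i j k - t * (side g i j k - side g i j l).
    by rewrite /side /cross /x !mxE; ring.
  by rewrite divfK ?subrr //; lra.
have {}xE : x = g i + m *: (g j - g i) by rewrite -xE addrC subrK.
(* The crossing point is beyond [i], beyond [j], or on the edge itself. The first two cases make an
   end interior to the hull; the third contradicts planarity, as the two edges share no vertex. *)
case: (ltP m 0) => m0.
  apply: (@on_hull_not_crossed _ _ g i j p q x (- m)) => //; last by rewrite oppr_gt0.
  by rewrite scaleNr opprK.
case: (ltP 1 m) => m1.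
  have swap r : side g j i r = - side g i j r by rewrite /side /cross !mxE; ring.
  apply: (@on_hull_not_crossed _ _ g j i q p x (m - 1)) => //.
  - by rewrite swap oppr_gt0.
  - by rewrite swap oppr_lt0.
  - by rewrite xE; apply: rowv2P; rewrite !mxE; ring.
  - by rewrite subr_gt0.
have [_ _ noX _] := Gplanar.
have [|||v] := noX i j k l aij akl _ x.
- apply/eqP => E; have := set21 i j; rewrite E !inE => /orP[]/eqP E'.
    by move: kS; rewrite -E' set21.
  by move: lS; rewrite -E' set21.
- by exists m; [rewrite m0 m1 | rewrite xE; apply: rowv2P; rewrite !mxE; ring].
- by exists t.
- rewrite inE => /andP[vij]; rewrite !inE => /orP[]/eqP E _.
    by move: kS; rewrite -E vij.
  by move: lS; rewrite -E vij.
Qed.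

(** If the two edges left [i] in the same direction, the end of the shorter would lie on the
    longer. *)
Lemma edges_not_overlapping i j k : j \in rot G i -> k \in rot G i -> j != k ->
  cross (g j - g i) (g k - g i) = 0 -> dot (g j - g i) (g k - g i) < 0.
Proof.
have [injg onseg _ _] := Gplanar.
have nz j' : j' \in rot G i -> g j' - g i != 0.
  move=> aj; rewrite subr_eq0; apply: contraTneq aj => /injg ->; exact: rot_irrefl.
move=> aj ak njk c0; rewrite ltNge; apply/negP => d0.
have key j' k' (t : R) : j' \in rot G i -> k' \in rot G i -> j' != k' ->
    0 <= t <= 1 -> g k' - g i = t *: (g j' - g i) -> False.
  move=> aj' ak' njk' t01 E.
  have [|Ek|Ek] := onseg i j' k' aj'.
  - exists t => //; move/matrixP: E => E.
    by apply: rowv2P; [move: (E 0 0) | move: (E 0 1)]; rewrite !mxE => ?; lra.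
  - by move: ak'; rewrite Ek (negbTE (rot_irrefl _ _)).
  - by rewrite Ek eqxx in njk'.
have E := parallel_coef (nz _ aj) c0.
set t := (X in _ = X *: _) in E.
have t0 : 0 <= t by rewrite divr_ge0 // ltW // dot_gt0 // nz.
case: (leP t 1) => t1; first by apply: (key j k t) => //; rewrite t0.
apply: (key k j t^-1) => //; first by rewrite eq_sym.
  by rewrite invr_ge0 t0 /= invf_le1; lra.
by rewrite E scalerA mulVf ?scale1r //; lra.
Qed.

(** Of three edges on one line two would point the same way: pairwise negative dot products
    contradict [dot u v * dot v w = dot v v * dot u w], valid for parallel vectors. *)
Lemma edges_not_collinear i a b c :
  a \in rot G i -> b \in rot G i -> c \in rot G i -> uniq [:: a; b; c] ->
  ~ [/\ cross (g a - g i) (g b - g i) = 0, cross (g b - g i) (g c - g i) = 0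
      & cross (g a - g i) (g c - g i) = 0].
Proof.
move=> ha hb hc; rewrite /= !inE negb_or andbT => /andP[/andP[nab nac] nbc] [cab cbc cac].
have dab := edges_not_overlapping ha hb nab cab.
have dbc := edges_not_overlapping hb hc nbc cbc.
have dac := edges_not_overlapping ha hc nac cac.
move: (g a - g i) (g b - g i) (g c - g i) cab cbc dab dbc dac => u v w cuv cvw uv vw uw.
have : dot u v * dot v w = dot v v * dot u w + cross u v * cross v w.
  by rewrite /dot /cross; ring.
have vv : 0 <= dot v v by rewrite /dot; nra.
rewrite cuv mul0r addr0; nra.
Qed.

(** Here [v] is a negative multiple of [u], so [cross v w] is a positive multiple of [cross w u],
    and their product can be nonpositive only if both vanish. *)
Lemma opposite_edges_cross (u v w : 'rV[R]_2) :
  (cross u v = 0 -> dot u v < 0) -> cross u v = 0 -> cross v w * cross w u <= 0 ->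
  cross v w = 0 /\ cross w u = 0.
Proof.
move=> h c0 le0; have {h} d0 := h c0.
have u0 : 0 < dot u u.
  by apply: dot_gt0; apply: contraTneq d0 => ->; rewrite /dot !mxE !mul0r addr0 ltxx.
have v0 : 0 < dot v v.
  by apply: dot_gt0; apply: contraTneq d0 => ->; rewrite /dot !mxE !mulr0 addr0 ltxx.
(* [E1] and [E2] are the dot products of [cross_relation] with [u] and with [v]. *)
have E1 : cross v w * dot u u + cross w u * dot u v + cross u v * dot u w = 0.
  by rewrite /cross /dot; ring.
have E2 : cross v w * dot u v + cross w u * dot v v + cross u v * dot v w = 0.
  by rewrite /cross /dot; ring.
rewrite c0 mul0r addr0 in E1; rewrite c0 mul0r addr0 in E2.
have key (a b p q : R) : 0 < p -> q < 0 -> a * b <= 0 -> a * p + b * q = 0 -> a = 0.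
  move=> p0 q0 ab E; have : a ^+ 2 * p + (a * b) * q = 0.
    by rewrite (_ : _ + _ = a * (a * p + b * q)); [rewrite E mulr0 | ring].
  have h1 : 0 <= a * b * q by rewrite nmulr_lge0.
  have h2 : 0 <= a ^+ 2 * p by rewrite mulr_ge0 ?sqr_ge0 ?ltW.
  move=> E'; have : a ^+ 2 * p = 0 by lra.
  by move/eqP; rewrite mulf_eq0 sqrf_eq0 (gt_eqF p0) orbF => /eqP.
split; first exact: key u0 d0 le0 E1.
by apply: key v0 d0 _ _; [rewrite mulrC; exact: le0 | rewrite addrC].
Qed.

(** If all three were one-sided, the three cyclic cross products would have pairwise nonpositive
    products. The square of their product is then nonpositive, so one of them vanishes; that pair of
    edges is opposite, which forces all three edges onto one line. *)
Lemma not_all_one_sided i a b c :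
  a \in rot G i -> b \in rot G i -> c \in rot G i -> uniq [:: a; b; c] ->
  one_sided g i a -> one_sided g i b -> ~~ one_sided g i c.
Proof.
move=> ha hb hc U oa ob; apply/negP => oc.
have os j p q : one_sided g i j -> 0 <= side g i j p * side g i j q.
  move=> h; rewrite leNgt; apply: contra h.
  case: (ltP 0 (side g i j p)) => hp.
    by rewrite pmulr_rlt0 // => hq; apply/andP; split; apply/existsP; [exists p | exists q].
  move: hp; rewrite le_eqVlt => /orP[/eqP ->|hp]; first by rewrite mul0r ltxx.
  by rewrite nmulr_rlt0 // => hq; apply/andP; split; apply/existsP; [exists q | exists p].
have := os a b c oa; have := os b c a ob; have := os c a b oc.
have := @edges_not_collinear i a b c ha hb hc U.
move: U; rewrite /= !inE negb_or andbT => /andP[/andP[nab nac] nbc].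
have dab := edges_not_overlapping ha hb nab.
have dbc := edges_not_overlapping hb hc nbc.
have dac := edges_not_overlapping ha hc nac.
rewrite /side; move: (g a - g i) (g b - g i) (g c - g i) dab dbc dac.
move=> u v w dab dbc dac ncol h3 h2 h1.
have cC (x y : 'rV[R]_2) : cross x y = - cross y x by rewrite /cross; ring.
have dC (x y : 'rV[R]_2) : dot x y = dot y x by rewrite /dot; ring.
rewrite (cC u w) in h1; rewrite (cC v u) in h2; rewrite (cC w v) in h3.
have {}h1 : cross w u * cross u v <= 0 by lra.
have {}h2 : cross u v * cross v w <= 0 by lra.
have {}h3 : cross v w * cross w u <= 0 by lra.
have : cross u v * cross v w * cross w u = 0.
  apply/eqP; rewrite -sqrf_eq0 eq_le sqr_ge0 andbT.
  rewrite (_ : _ ^+ 2 = cross w u * cross u v * (cross u v * cross v w)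
                        * (cross v w * cross w u)); last by ring.
  by rewrite mulr_ge0_le0 // mulr_le0.
have dca : cross w u = 0 -> dot w u < 0.
  by move=> c0; rewrite dC; apply: dac; rewrite cC c0 oppr0.
move/eqP; rewrite !mulf_eq0 -orbA => /or3P[] /eqP c0; apply: ncol.
- by have [] := opposite_edges_cross dab c0 h3; rewrite (cC u w) => -> ->; rewrite oppr0.
- by have [] := opposite_edges_cross dbc c0 h1; rewrite (cC u w) => -> ->; rewrite oppr0.
- by have [] := opposite_edges_cross dca c0 h2; rewrite (cC u w) c0 => -> ->; rewrite oppr0.
Qed.

End PlanarDrawing.

(** * The outer face *)

Section CubicPlaneGraph.
Context {n : nat} (G : plane_graph n).

Definition nbr (k : nat) (i : 'I_n) : 'I_n := nth i (rot G i) k.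

Lemma face_next_inj : injective (face_next G).
Proof.
move=> [a b] [c d] [/= <-] E; congr pair.
by rewrite -(prev_next (rot_uniq G b) a) E prev_next // rot_uniq.
Qed.

Lemma adj_iter_face_next k d : adj G d.1 d.2 ->
  adj G (iter k (face_next G) d).1 (iter k (face_next G) d).2.
Proof.
move=> ad; elim: k => [//|k IH]; rewrite iterS /= /adj mem_next -rot_sym.
exact: IH.
Qed.

Context (cubG : cubic G).

Lemma rot_nbr i : rot G i = [:: nbr 0 i; nbr 1 i; nbr 2 i].
Proof. by have := cubG i; rewrite /nbr; case: (rot G i) => [|a [|b [|c []]]]. Qed.

Lemma nbr_neq i : [/\ nbr 0 i != nbr 1 i, nbr 0 i != nbr 2 i & nbr 1 i != nbr 2 i].
Proof.
have := rot_uniq G i; rewrite rot_nbr /= !inE negb_or andbT.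
by move=> /andP[/andP[-> ->] ->].
Qed.

Lemma rot_nbrE i j : (j \in rot G i) = [|| j == nbr 0 i, j == nbr 1 i | j == nbr 2 i].
Proof. by rewrite rot_nbr !inE. Qed.

Lemma nbr_in_rot i k : (k < 3)%N -> nbr k i \in rot G i.
Proof. by move=> k3; rewrite mem_nth // cubG. Qed.

Lemma next_nbr i : [/\ next (rot G i) (nbr 0 i) = nbr 1 i,
  next (rot G i) (nbr 1 i) = nbr 2 i & next (rot G i) (nbr 2 i) = nbr 0 i].
Proof.
move: (nbr_neq i); rewrite rot_nbr.
move: (nbr 0 i) (nbr 1 i) (nbr 2 i) => a b c [nab nac nbc]; split=> /=.
- by rewrite eqxx.
- by rewrite eq_sym (negbTE nab) eqxx.
- by rewrite eq_sym (negbTE nac) eq_sym (negbTE nbc) eqxx.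
Qed.

(** The graph has [3 * n] darts, so a walk of that length goes all around a face. *)
Lemma face_vertices_iter d i : adj G d.1 d.2 ->
  reflect (exists2 k, (k < 3 * n)%N & (iter k (face_next G) d).1 = i)
          (i \in face_vertices G d).
Proof.
move=> ad; apply: (iffP imsetP) => [[e ed ->]|[k k3 <-]]; last first.
  by exists (iter k (face_next G) d); rewrite // -fconnect_orbit fconnect_iter.
have [k kd ->] := trajectP ed.
exists k => //; apply: leq_trans kd _.
rewrite -size_orbit.
have -> : (3 * n)%N = size [seq (i, j) | i <- enum 'I_n, j <- rot G i].
  rewrite size_allpairs_dep sumnE big_map big_enum (eq_bigr (fun=> 3%N)) //.
  by rewrite sum_nat_const card_ord mulnC.
apply: uniq_leq_size (orbit_uniq _ _) _ => -[a b] /trajectP[l _ E].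
apply/allpairsPdep; exists a, b; split => //; first exact: mem_enum.
have := adj_iter_face_next l ad.
by rewrite -E.
Qed.

End CubicPlaneGraph.

Section OuterFace.
Context {R : realType} {n : nat} (G : plane_graph n) (g : 'I_n -> 'rV[R]_2).
Context (cubG : cubic G) (G3 : triconnected G).
Context (Gplanar : straight_line_planar_drawing G g)
           (Gface : hull_vertices_form_face G g).

Lemma exists_crossed_edge i :
  exists2 k, (k < 3)%N & ~~ one_sided g i (nbr G k i).
Proof.
have [o0|] := boolP (one_sided g i (nbr G 0 i)); last by exists 0%N.
have [o1|] := boolP (one_sided g i (nbr G 1 i)); last by exists 1%N.
have last_crossed := not_all_one_sided Gplanar _ _ _ _ o0 o1.
exists 2%N => //; apply: last_crossed; try exact: nbr_in_rot.
by have := rot_uniq G i; rewrite rot_nbr.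
Qed.

Lemma outer_face_dart i k : on_hull g i -> (k < 3)%N ->
  ~~ one_sided g i (nbr G k i) ->
  forall j, j \in face_vertices G (i, nbr G ((k + 2) %% 3) i) <-> on_hull g j.
Proof.
move=> hi k3 nok; have [d [ad hd]] := Gface.
have /hd/imsetP[[i' y] ed /= Ei] := hi; rewrite -{i'}Ei in ed *.
have finj := @face_next_inj n G.
have sameface j : j \in face_vertices G (i, y) <-> on_hull g j.
  rewrite -hd; suff -> : face_vertices G (i, y) = face_vertices G d by [].
  apply/setP => l; apply/imsetP/imsetP => -[e he ->]; exists e => //;
    move: ed he; rewrite -!fconnect_orbit => ed he.
    exact: connect_trans ed he.
  by apply: connect_trans he; rewrite fconnect_sym.
have aiy : y \in rot G i.
  have [l _ E] := trajectP ed.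
  by have := adj_iter_face_next l ad; rewrite -E.
have mem_face e : fconnect (face_next G) (i, y) e -> on_hull g e.1.
  by move=> h; apply/sameface/imsetP; exists e; rewrite -?fconnect_orbit.
have hy : on_hull g y.
  by have := mem_face _ (fconnect1 (face_next G) (i, y)).
(* The predecessor dart on the face, available because [face_next] is injective. *)
pose x := (finv (face_next G) (i, y)).1.
have [xi xy] : (finv (face_next G) (i, y)).2 = i /\ next (rot G i) x = y.
  have := f_finv finj (i, y); rewrite /x; case: (finv _ _) => a b /= [-> <-].
  by [].
have hx : on_hull g x by apply: mem_face; rewrite fconnect_finv.
have aix : x \in rot G i by rewrite -mem_next xy.
have ox := hull_edge_one_sided G3 Gplanar aix hi hx.
have oy := hull_edge_one_sided G3 Gplanar aiy hi hy.
suff -> : nbr G ((k + 2) %% 3) i = y by [].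
have [nx0 nx1 nx2] := next_nbr cubG i.
have [n01 n02 n12] := nbr_neq cubG i.
have nx : x != nbr G k i by apply: contraNneq nok => <-.
have ny : y != nbr G k i by apply: contraNneq nok => <-.
move: aix; rewrite rot_nbrE // => /or3P[] /eqP Ex; move: xy nx ny;
  rewrite Ex ?nx0 ?nx1 ?nx2 => <-; case: k k3 {nok} => [|[|[|//]]] _ //=; rewrite ?eqxx //.
Qed.

End OuterFace.

(** * Barycentric coordinates *)

Section Barycenter.
Context {R : realType} {n : nat} (G : plane_graph n) (g : 'I_n -> 'rV[R]_2).
Context (cubG : cubic G) (Gplanar : straight_line_planar_drawing G g).

(** The coefficient of [j] in [cross_relation] for the edge vectors at [i] in rotation order. *)
Definition corner (i j : 'I_n) : R :=
  cross (g (next (rot G i) j) - g i) (g (next (rot G i) (next (rot G i) j)) - g i).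

Definition bary (i j : 'I_n) : R := corner i j / \sum_(k <- rot G i) corner i k.

Lemma sum_nbr (V : nmodType) (F : 'I_n -> V) i :
  \sum_(j | adj G i j) F j = F (nbr G 0 i) + F (nbr G 1 i) + F (nbr G 2 i).
Proof.
rewrite -(big_uniq _ (rot_uniq G i)) /= rot_nbr //.
by rewrite !big_cons big_nil addr0 addrA.
Qed.

Lemma bary_nbr i (u := g (nbr G 0 i) - g i) (v := g (nbr G 1 i) - g i)
    (w := g (nbr G 2 i) - g i) (t := cross v w + cross w u + cross u v) :
  [/\ bary i (nbr G 0 i) = cross v w / t, bary i (nbr G 1 i) = cross w u / t
    & bary i (nbr G 2 i) = cross u v / t].
Proof.
have [nx0 nx1 nx2] := next_nbr cubG i.
rewrite /bary (_ : \sum_(k <- _) _ = t); last first.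
  rewrite big_uniq ?rot_uniq //= sum_nbr.
  by rewrite /corner nx0 nx1 nx2 nx0.
by rewrite /corner nx0 nx1 nx2 nx0.
Qed.

(** Vectors that are not all parallel satisfy only one linear relation up to scale, so the given one
    is proportional to [cross_relation]. *)
Lemma relation_ratio (u v w : 'rV[R]_2) (a b c : R)
    (t := cross v w + cross w u + cross u v) :
  0 < a -> 0 < b -> 0 < c -> a *: u + b *: v + c *: w = 0 ->
  ~ [/\ cross u v = 0, cross v w = 0 & cross u w = 0] ->
  [/\ cross v w / t = a / (a + b + c), cross w u / t = b / (a + b + c)
    & cross u v / t = c / (a + b + c)].
Proof.
move=> a0 b0 c0 /matrixP E ncol.
have {E} [] := (E 0 0, E 0 1); rewrite !mxE => E0 E1.
have W0 : a + b + c != 0 by lra.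
have an := lt0r_neq0 a0.
(* Cross product of the given relation with [w]; [cA] uses [v] in the same way. *)
have bA : b * cross v w = a * cross w u.
  apply/eqP; rewrite -subr_eq0; apply/eqP.
  transitivity ((a * u 0 0 + b * v 0 0 + c * w 0 0) * w 0 1
                - (a * u 0 1 + b * v 0 1 + c * w 0 1) * w 0 0).
    by rewrite /cross; ring.
  by rewrite E0 E1 !mul0r subrr.
have cA : c * cross v w = a * cross u v.
  apply/eqP; rewrite -subr_eq0; apply/eqP.
  transitivity ((a * u 0 1 + b * v 0 1 + c * w 0 1) * v 0 0
                - (a * u 0 0 + b * v 0 0 + c * w 0 0) * v 0 1).
    by rewrite /cross; ring.
  by rewrite E0 E1 !mul0r subrr.
have tA : t = (a + b + c) / a * cross v w.
  apply: (mulfI an).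
  transitivity (a * cross v w + b * cross v w + c * cross v w); last by field.
  by rewrite bA cA /t; ring.
have A0 : cross v w != 0.
  apply/eqP => A0; apply: ncol; split => //.
    by apply: (mulfI (lt0r_neq0 a0)); rewrite -cA A0 !mulr0.
  have := bA; rewrite A0 mulr0 => /esym/eqP; rewrite mulf_eq0 gt_eqF //= => /eqP.
  by rewrite /cross => h; rewrite -[RHS]oppr0 -h; ring.
have BA : cross w u = b / a * cross v w by rewrite mulrAC bA mulrAC divff ?mul1r ?lt0r_neq0.
have CA : cross u v = c / a * cross v w by rewrite mulrAC cA mulrAC divff ?mul1r ?lt0r_neq0.
by rewrite tA BA CA; split; field; rewrite ?A0 ?W0 ?an.
Qed.

(** By uniqueness of the coordinates, [w i j] is [bary i j] times the sum of the weights at [i].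
    This sum is the scale [s i], and the edge equation is the symmetry of [w]. *)
Lemma weighted_barycenterP (ext : pred 'I_n) : (forall i, ext i <-> on_hull g i) ->
  weighted_barycenter_drawing G g <->
  exists s : 'I_n -> R,
    [/\ forall i, ~~ ext i -> 0 < s i,
        forall i j, ~~ ext i -> j \in rot G i -> 0 < bary i j
      & forall i j, ~~ ext i -> ~~ ext j -> j \in rot G i ->
          s i * bary i j = s j * bary j i].
Proof.
move=> extP; have intP i : internal g i <-> ~~ ext i.
  by rewrite /internal /external -extP; split => /negP.
split=> [[w [wpos wbar]]|[s [s0 bary0 sbary]]].
  have ws i j : ~~ ext i -> j \in rot G i -> w i j = w j i /\ 0 < w i j.
    by move=> /intP ii ij; apply: wpos; split=> //; left.
  have baryE i : ~~ ext i -> forall j, j \in rot G i ->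
      bary i j = w i j / (\sum_(k | adj G i k) w i k).
    move=> ei; have [_ w0] := ws _ _ ei (nbr_in_rot cubG i (isT : 0 < 3)%N).
    have [_ w1] := ws _ _ ei (nbr_in_rot cubG i (isT : 1 < 3)%N).
    have [_ w2] := ws _ _ ei (nbr_in_rot cubG i (isT : 2 < 3)%N).
    have /intP/wbar := ei; rewrite !sum_nbr => E.
    have [b0 b1 b2] := bary_nbr i.
    have U : uniq [:: nbr G 0 i; nbr G 1 i; nbr G 2 i].
      by have := rot_uniq G i; rewrite rot_nbr.
    have ncol := edges_not_collinear Gplanar (nbr_in_rot cubG i (isT : 0 < 3)%N)
      (nbr_in_rot cubG i (isT : 1 < 3)%N) (nbr_in_rot cubG i (isT : 2 < 3)%N) U.
    have [|e0 e1 e2] := relation_ratio w0 w1 w2 _ ncol; last first.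
      by move=> j; rewrite rot_nbrE // => /or3P[] /eqP ->; rewrite ?b0 ?b1 ?b2.
    set W := (_ + _ + _) in E.
    have W0 : W != 0 by rewrite /W; lra.
    have {}E : W *: g i = w i (nbr G 0 i) *: g (nbr G 0 i) +
        w i (nbr G 1 i) *: g (nbr G 1 i) + w i (nbr G 2 i) *: g (nbr G 2 i).
      by rewrite {1}E scalerA divff // scale1r.
    move/matrixP: E => E.
    by apply: rowv2P; [move: (E 0 0) | move: (E 0 1)]; rewrite !mxE /W => ?; lra.
  have W0 i : ~~ ext i -> 0 < \sum_(k | adj G i k) w i k.
    move=> ei; rewrite sum_nbr.
    have [_ w0] := ws _ _ ei (nbr_in_rot cubG i (isT : 0 < 3)%N).
    have [_ w1] := ws _ _ ei (nbr_in_rot cubG i (isT : 1 < 3)%N).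
    have [_ w2] := ws _ _ ei (nbr_in_rot cubG i (isT : 2 < 3)%N).
    by rewrite !addr_gt0.
  exists (fun i => \sum_(k | adj G i k) w i k); split=> //.
  - move=> i j ei ij; rewrite baryE // divr_gt0 ?W0 //.
    by have [] := ws _ _ ei ij.
  - move=> i j ei ej ij; have ji : i \in rot G j by rewrite rot_sym.
    rewrite !baryE // ![_ * (_ / _)]mulrC !divfK ?gt_eqF ?W0 //.
    by have [] := ws _ _ ei ij.
(* An edge with one external end gets its weight from the internal end, whichever way it is read. *)
exists (fun i j => if ext i then s j * bary j i else s i * bary i j); split.
  move=> i j [ij [/intP ei|/intP ej]].
    have [ej|ej] := boolP (ext j); rewrite (negbTE ei).
      by rewrite mulr_gt0 ?s0 ?bary0.
    by rewrite mulr_gt0 ?s0 ?bary0 // sbary.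
  have ji : i \in rot G j by rewrite rot_sym.
  have [ei|ei] := boolP (ext i); rewrite (negbTE ej).
    by rewrite mulr_gt0 ?s0 ?bary0.
  by rewrite mulr_gt0 ?s0 ?bary0 // sbary.
move=> i /intP ei; rewrite !sum_nbr (negbTE ei).
have := bary0 i _ ei (nbr_in_rot cubG i (isT : 0 < 3)%N).
have [-> -> ->] := bary_nbr i.
have := cross_relation (g (nbr G 0 i) - g i) (g (nbr G 1 i) - g i) (g (nbr G 2 i) - g i).
move: (g (nbr G 0 i)) (g (nbr G 1 i)) (g (nbr G 2 i)) (g i) (s i) (s0 i ei) => u v w x r r0.
move: (cross (v - x) _) (cross (w - x) _) (cross (u - x) _) => A B C /matrixP E.
set t := A + B + C => At0.
(* Division by 0 gives 0, so a positive coordinate excludes [t = 0]. *)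
have tn0 : t != 0 by apply: contraTneq At0 => ->; rewrite invr0 mulr0 ltxx.
have rn0 := lt0r_neq0 r0.
have -> : r * (A / t) + r * (B / t) + r * (C / t) = r.
  by rewrite -!mulrDr -!mulrDl divff ?mulr1.
have coord p a b c : A * (a - p) + B * (b - p) + C * (c - p) = 0 ->
    p = r^-1 * (r * (A / t) * a + r * (B / t) * b + r * (C / t) * c).
  move=> h; apply: (mulfI tn0).
  transitivity (A * a + B * b + C * c); first by rewrite /t; lra.
  by field; rewrite rn0 tn0.
by apply: rowv2P; [move: (E 0 0)|move: (E 0 1)]; rewrite !mxE => /coord.
Qed.

End Barycenter.

(** * The algorithm *)

Definition side_exp (i j k : iexp) : rexp :=
  RSub (RMul (RSub (RGet 0 j) (RGet 0 i)) (RSub (RGet 1 k) (RGet 1 i)))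
       (RMul (RSub (RGet 1 j) (RGet 1 i)) (RSub (RGet 0 k) (RGet 0 i))).

(* Natural registers: 0 the input [n] and finally the answer, 1 the loop
   counter, 2 a leftmost vertex, 3 its neighbour under test, 4 and 5 whether
   there are vertices strictly to the left and to the right of the edge 2-3,
   6 and 7 the head and the tail of the dart reached by the walk, 8 and 9 the
   ends of the edge at hand (8 also a temporary of the walk), 10 and 11 the
   first pending cell and the size of the queue, 12 the next root to try,
   13 the verdict.
   Natural arrays: 0 to 2 the rotations, 3 the marks of the outer face, 4 the
   queue, 5 the marks of the vertices put in the queue.
   Real arrays: 0 and 1 the coordinates, 2 to 4 the barycentric coordinates,
   5 the scales. *)
Definition leftmost_prog : prog :=
  ISet 2 (ICst 0) ;;
  For 1 (If (RLe (RGet 0 (IReg 2)) (RGet 0 (IReg 1))) Skip (ISet 2 (IReg 1))).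

(** The two flags add up to 2 exactly when the edge is crossed; the place [m + 2] is that of
    [outer_face_dart]. *)
Definition crossed_prog (m : nat) : prog :=
  ISet 3 (IGet m (IReg 2)) ;; ISet 4 (ICst 0) ;; ISet 5 (ICst 0) ;;
  For 1 (RSet 0 (side_exp (IReg 2) (IReg 3) (IReg 1)) ;;
         If (RLe (RReg 0) (RCst 0)) Skip (ISet 4 (ICst 1)) ;;
         If (RLe (RCst 0) (RReg 0)) Skip (ISet 5 (ICst 1))) ;;
  If (IEq (IAdd (IReg 4) (IReg 5)) (ICst 2))
     (ISet 6 (IGet ((m + 2) %% 3) (IReg 2))) Skip.

(** The nested tests compute [next] in a rotation of length three. *)
Definition walk_prog : prog :=
  ISet 7 (IReg 2) ;;
  For 3 (IPut 3 (IReg 7) (ICst 1) ;;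
         If (IEq (IGet 0 (IReg 6)) (IReg 7)) (ISet 8 (IGet 1 (IReg 6)))
            (If (IEq (IGet 1 (IReg 6)) (IReg 7)) (ISet 8 (IGet 2 (IReg 6)))
                (ISet 8 (IGet 0 (IReg 6)))) ;;
         ISet 7 (IReg 6) ;; ISet 6 (IReg 8)).

Definition bary_prog : prog :=
  For 1 (RSet 0 (side_exp (IReg 1) (IGet 1 (IReg 1)) (IGet 2 (IReg 1))) ;;
         RSet 1 (side_exp (IReg 1) (IGet 2 (IReg 1)) (IGet 0 (IReg 1))) ;;
         RSet 2 (side_exp (IReg 1) (IGet 0 (IReg 1)) (IGet 1 (IReg 1))) ;;
         RSet 3 (RAdd (RAdd (RReg 0) (RReg 1)) (RReg 2)) ;;
         RPut 2 (IReg 1) (RDiv (RReg 0) (RReg 3)) ;;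
         RPut 3 (IReg 1) (RDiv (RReg 1) (RReg 3)) ;;
         RPut 4 (IReg 1) (RDiv (RReg 2) (RReg 3))).

(** Coordinates are stored by place in the rotation, so the place of [u] at [v] must be found
    first. *)
Definition read_bary (v u : iexp) : prog :=
  If (IEq (IGet 0 v) u) (RSet 0 (RGet 2 v))
     (If (IEq (IGet 1 v) u) (RSet 0 (RGet 3 v)) (RSet 0 (RGet 4 v))).

Definition push_prog : prog :=
  IPut 5 (IReg 9) (ICst 1) ;; IPut 4 (IReg 11) (IReg 9) ;;
  ISet 11 (IAdd (IReg 11) (ICst 1)).

(** The new scale solves the edge equation between registers 8 and 9. *)
Definition visit_prog (k : nat) : prog :=
  ISet 9 (IGet k (IReg 8)) ;;
  If (BAnd (IEq (IGet 3 (IReg 9)) (ICst 0)) (IEq (IGet 5 (IReg 9)) (ICst 0)))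
     (read_bary (IReg 9) (IReg 8) ;;
      RPut 5 (IReg 9) (RDiv (RMul (RGet 5 (IReg 8)) (RGet (2 + k) (IReg 8))) (RReg 0)) ;;
      push_prog)
     Skip.

Definition examine_prog : prog :=
  ISet 8 (IGet 4 (IReg 10)) ;;
  visit_prog 0 ;; visit_prog 1 ;; visit_prog 2 ;;
  ISet 10 (IAdd (IReg 10) (ICst 1)).

(** Scales in a component of the internal vertices matter only up to a common factor, so a root may
    receive 1. The bound on register 12 is tested because rounds may remain after the last root. *)
Definition start_prog : prog :=
  If (BAnd (ILe (IAdd (IReg 12) (ICst 1)) (IReg 0))
           (BAnd (IEq (IGet 3 (IReg 12)) (ICst 0)) (IEq (IGet 5 (IReg 12)) (ICst 0))))
     (ISet 9 (IReg 12) ;; RPut 5 (IReg 9) (RCst 1) ;; push_prog) Skip ;;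
  ISet 12 (IAdd (IReg 12) (ICst 1)).

(** Each round advances either the head of the queue or the next root, whence [2 * n] rounds. *)
Definition scale_prog : prog :=
  ISet 10 (ICst 0) ;; ISet 11 (ICst 0) ;; ISet 12 (ICst 0) ;;
  For 2 (If (ILe (IAdd (IReg 10) (ICst 1)) (IReg 11)) examine_prog start_prog).

Definition check_edge (k : nat) : prog :=
  If (RLe (RGet (2 + k) (IReg 1)) (RCst 0)) (ISet 13 (ICst 0)) Skip ;;
  ISet 9 (IGet k (IReg 1)) ;;
  If (IEq (IGet 3 (IReg 9)) (ICst 0))
     (read_bary (IReg 9) (IReg 1) ;;
      If (REq (RMul (RGet 5 (IReg 1)) (RGet (2 + k) (IReg 1)))
              (RMul (RGet 5 (IReg 9)) (RReg 0)))
         Skip (ISet 13 (ICst 0)))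
     Skip.

Definition check_prog : prog :=
  ISet 13 (ICst 1) ;;
  For 1 (If (IEq (IGet 3 (IReg 1)) (ICst 0))
            (If (RLe (RGet 5 (IReg 1)) (RCst 0)) (ISet 13 (ICst 0)) Skip ;;
             check_edge 0 ;; check_edge 1 ;; check_edge 2)
            Skip) ;;
  ISet 0 (IReg 13).

Definition recognition_prog : prog :=
  leftmost_prog ;; (crossed_prog 0 ;; crossed_prog 1 ;; crossed_prog 2) ;;
  walk_prog ;; bary_prog ;; scale_prog ;; check_prog.

Lemma exists_ltnS n (P : pred 'I_n) k (kn : (k < n)%N) :
  [exists v : 'I_n, (v < k.+1)%N && P v] =
  [exists v : 'I_n, (v < k)%N && P v] || P (Ordinal kn).
Proof.
apply/existsP/orP => [[v /andP[]]|[/existsP[v /andP[vk Pv]]|Pk]].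
- rewrite ltnS leq_eqVlt => /orP[/eqP vk Pv|vk Pv].
    by right; rewrite (_ : Ordinal kn = v) //; apply: val_inj.
  by left; apply/existsP; exists v; rewrite vk.
- by exists v; rewrite Pv ltnS ltnW.
- by exists (Ordinal kn); rewrite Pk /= ltnSn.
Qed.

Lemma exists_lt0 n (P : pred 'I_n) : [exists v : 'I_n, (v < 0)%N && P v] = false.
Proof. by apply/existsP => -[v]. Qed.

Lemma exists_ltn n (P : pred 'I_n) :
  [exists v : 'I_n, (v < n)%N && P v] = [exists v, P v].
Proof. by apply: eq_existsb => v; rewrite ltn_ord. Qed.

(** * Correctness of the preparatory stages *)

Section Recognition.
Context {R : realType} {n : nat} (G : plane_graph n) (g : 'I_n -> 'rV[R]_2).
Context (cubG : cubic G) (G3 : triconnected G).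
Context (Gplanar : straight_line_planar_drawing G g)
           (Gface : hull_vertices_form_face G g).
Implicit Types (s : state R) (i j u v : 'I_n).

Definition holds_input s : Prop :=
  [/\ ireg s 0 = n,
      forall v, [/\ iarr s 0 v = nbr G 0 v, iarr s 1 v = nbr G 1 v
                   & iarr s 2 v = nbr G 2 v]
    & forall v, rarr s 0 v = g v 0 0 /\ rarr s 1 v = g v 0 1].

Definition unmarked s : Prop := forall v, iarr s 3 v = 0%N /\ iarr s 5 v = 0%N.

Lemma input_nbr s k v : holds_input s -> (k < 3)%N -> iarr s k v = nbr G k v.
Proof. by move=> [_ /(_ v)[? ? ?] _]; case: k => [|[|[|]]]. Qed.

Lemma n_gt0 : (0 < n)%N.
Proof. by have [n3 _] := G3; lia. Qed.

Lemma reval_side s e1 e2 e3 i j (k : 'I_n) : holds_input s ->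
  ieval s e1 = i -> ieval s e2 = j -> ieval s e3 = k ->
  reval s (side_exp e1 e2 e3) = side g i j k.
Proof.
move=> [_ _ xy] /= -> -> ->; have [xi yi] := xy i; have [xj yj] := xy j.
by have [xk yk] := xy k; rewrite /side /cross !mxE xi yi xj yj xk yk.
Qed.

Lemma leftmost_triple :
  triple n (fun s => holds_input s /\ unmarked s) leftmost_prog
    (fun s => exists i, [/\ holds_input s, unmarked s, ireg s 2 = i & on_hull g i]).
Proof.
pose J k s := holds_input s /\ unmarked s /\
  exists i, ireg s 2 = i /\ forall j, (j < k)%N -> g i 0 0 <= g j 0 0.
apply: (triple_seq (Q := J 0%N)).
  apply: triple_loop_free n_gt0 _ _ => // s [hs us]; split=> //; split=> //.
  by exists (Ordinal n_gt0).
have fin : triple n (J 0%N)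
    (For 1 (If (RLe (RGet 0 (IReg 2)) (RGet 0 (IReg 1))) Skip (ISet 2 (IReg 1))))
    (J (1 * n)%N).
  apply: triple_for => //; first exact: n_gt0.
  - by move=> k s [[]].
  - move=> k s kn sk [hs [us [i [s2 left_i]]]].
    rewrite mul1n in kn; pose v := Ordinal kn.
    have [_ _ xy] := hs; have [xi _] := xy i; have [xv _] := xy v.
    rewrite /= s2 sk xi (xv : rarr s 0 k = _).
    case: ifPn => [le_iv|lt_vi]; (split; first by rewrite /= ?sk); split=> //; split=> //.
      exists i; split=> // j; rewrite ltnS leq_eqVlt => /orP[/eqP jk|]; last exact: left_i.
      by rewrite (_ : j = v) //; apply: val_inj.
    rewrite -ltNge in lt_vi; exists v; split; first by rewrite /= /upd.
    move=> j; rewrite ltnS leq_eqVlt => /orP[/eqP jk|jk].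
      by rewrite (_ : j = v) //; apply: val_inj.
    exact: le_trans (ltW lt_vi) (left_i j jk).
move=> s /fin[t [s' [e l [hs [us [i [s2 left_i]]]]]]].
exists t, s'; split=> //; exists i; split=> //; apply: on_hull_leftmost => j.
by apply: left_i; rewrite mul1n.
Qed.

Definition crossed_dart i s : Prop :=
  exists2 k, (k < 3)%N & ~~ one_sided g i (nbr G k i) /\
    ireg s 6 = nbr G ((k + 2) %% 3) i.

(** The dart is promised only if one of the first [l] edges is crossed; [exists_crossed_edge]
    discharges this after all three. *)
Lemma crossed_triple m : (m < 3)%N ->
  let P l s := exists i, [/\ holds_input s, unmarked s, ireg s 2 = i, on_hull g i
    & (exists2 k, (k < l)%N & ~~ one_sided g i (nbr G k i)) -> crossed_dart i s] in
  triple n (P m) (crossed_prog m) (P m.+1).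
Proof.
move=> m3 P; apply: triple_exists => i.
pose J k s := [/\ holds_input s, unmarked s, ireg s 2 = i /\ ireg s 3 = nbr G m i, on_hull g i
    & [/\ (exists2 k, (k < m)%N & ~~ one_sided g i (nbr G k i)) -> crossed_dart i s,
        ireg s 4 = [exists v : 'I_n, (v < k)%N && (0 < side g i (nbr G m i) v)]
      & ireg s 5 = [exists v : 'I_n, (v < k)%N && (side g i (nbr G m i) v < 0)]]].
apply: (triple_seq (Q := fun s => [/\ holds_input s, unmarked s,
    ireg s 2 = i /\ ireg s 3 = nbr G m i, on_hull g i &
    (exists2 k, (k < m)%N & ~~ one_sided g i (nbr G k i)) -> crossed_dart i s])).
  apply: triple_loop_free n_gt0 _ _ => // s [hs us s2 hi C].
  by split=> //; split=> //=; rewrite /upd /= s2 (input_nbr _ hs).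
apply: (triple_seq (Q := fun s => [/\ holds_input s, unmarked s,
    ireg s 2 = i /\ ireg s 3 = nbr G m i, on_hull g i &
    ((exists2 k, (k < m)%N & ~~ one_sided g i (nbr G k i)) -> crossed_dart i s) /\
     ireg s 4 = 0%N])).
  by apply: triple_loop_free n_gt0 _ _ => // s [hs us s23 hi C]; split.
apply: (triple_seq (Q := J 0%N)).
  apply: triple_loop_free n_gt0 _ _ => // s [hs us s23 hi [C s4]]; split=> //.
  by split=> //; rewrite exists_lt0 // -s4.
apply: (triple_seq (Q := J (1 * n)%N)).
  apply: triple_for => //; first exact: n_gt0.
  - by move=> k s [[]].
  - move=> k s kn sk [hs us [s2 s3] hi [C s4 s5]].
    rewrite mul1n in kn; pose v := Ordinal kn.
    have E : reval s (side_exp (IReg 2) (IReg 3) (IReg 1)) = side g i (nbr G m i) v.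
      by apply: reval_side.
    move: (side_exp _ _ _) E => b E; rewrite /= E /upd /=.
    set x := side g i (nbr G m i) v.
    split; first by case: ifP; case: ifP => //= _ _; rewrite /upd /= sk.
    have [e4 e5] : (0 < x) = ~~ (x <= 0) /\ (x < 0) = ~~ (0 <= x) by rewrite -!ltNge.
    rewrite /J !(exists_ltnS _ kn) /= -/v -/x e4 e5.
    by case: (x <= 0) => /=; rewrite /upd /=; case: (0 <= x) => /=;
      split=> //; split; rewrite //= /upd /= ?s4 ?s5 ?orbF ?orbT.
apply: triple_loop_free n_gt0 _ _ => // s [hs us [s2 s3] hi [C s4 s5]].
have nb k v := @input_nbr s k v hs; rewrite mul1n !exists_ltn in s4 s5.
have crossedE : (ireg s 4 + ireg s 5 == 2)%N = ~~ one_sided g i (nbr G m i).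
  by rewrite s4 s5 /one_sided negbK; do 2!case: [exists _, _].
exists i; rewrite /= crossedE; case: ifPn => [cr|nc]; split=> //.
  move=> _; exists m => //; split=> //=.
  by rewrite /upd /= s2 nb // ltn_mod.
move=> [k]; rewrite ltnS leq_eqVlt => /orP[/eqP ->|km cr]; first by move=> cr; case/negP: nc.
by apply: C; exists k.
Qed.

Lemma dart_triple :
  triple n (fun s => exists i, [/\ holds_input s, unmarked s, ireg s 2 = i & on_hull g i])
    (crossed_prog 0 ;; crossed_prog 1 ;; crossed_prog 2)
    (fun s => exists i, [/\ holds_input s, unmarked s, ireg s 2 = i, on_hull g i
       & crossed_dart i s]).
Proof.
have h0 := crossed_triple (isT : (0 < 3)%N); have h1 := crossed_triple (isT : (1 < 3)%N).
have h2 := crossed_triple (isT : (2 < 3)%N).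
have := triple_seq h0 (triple_seq h1 h2); apply: triple_conseq.
  by move=> s [i [hs us s2 hi]]; exists i; split=> // -[].
move=> s [i [hs us s2 hi C]]; exists i; split=> //.
by apply: C; exact: exists_crossed_edge.
Qed.

Definition ext : pred 'I_n := fun i => `[< on_hull g i >].

Definition marked s : Prop := forall v, iarr s 3 v = ext v.

Definition unvisited s : Prop := forall v, iarr s 5 v = 0%N.

Lemma walk_triple :
  triple n (fun s => exists i, [/\ holds_input s, unmarked s, ireg s 2 = i, on_hull g i
       & crossed_dart i s])
    walk_prog (fun s => [/\ holds_input s, marked s & unvisited s]).
Proof.
apply: triple_exists => i.
apply: (triple_conseq (P' := fun s => exists k, [/\ holds_input s, unmarked s,
    ireg s 2 = i /\ ireg s 6 = nbr G ((k + 2) %% 3) i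
  & [/\ on_hull g i, (k < 3)%N & ~~ one_sided g i (nbr G k i)]]) _ (fun s => id)).
  by move=> s [hs us s2 hi [k k3 [ck s6]]]; exists k.
apply: triple_exists => k.
set y := nbr G _ i; pose f := face_next G.
have ady : adj G (i, y).1 (i, y).2 by rewrite /adj /= nbr_in_rot // ltn_mod.
(* After [l] rounds the registers hold the [l]-th dart of the walk, and the tails of the earlier
   darts are marked. *)
pose J l s := [/\ holds_input s, unvisited s,
   on_hull g i /\ (k < 3)%N /\ ~~ one_sided g i (nbr G k i),
   ireg s 7 = (iter l f (i, y)).1 /\ ireg s 6 = (iter l f (i, y)).2
  & forall v, iarr s 3 v = [exists m : 'I_(3 * n), (m < l)%N && ((iter m f (i, y)).1 == v)]].
apply: (triple_seq (Q := J 0%N)).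
  apply: triple_loop_free n_gt0 _ _ => // s [hs us [s2 s6] [hi k3 ck]].
  split=> // v; first by have [] := us v.
  by rewrite exists_lt0 /=; have [] := us v.
apply: (triple_conseq (P' := J 0%N) (Q' := J (3 * n)%N)) => //.
  move=> s [hs us [hi [k3 ck]] _ ms]; split=> // v.
  rewrite ms exists_ltn; congr nat_of_bool; apply/existsP/asboolP.
    move=> [m /eqP mv]; apply/(outer_face_dart cubG G3 Gplanar Gface hi k3 ck v).
    by apply/(face_vertices_iter cubG _ ady); exists m.
  move=> /(outer_face_dart cubG G3 Gplanar Gface hi k3 ck v).
  move=> /(face_vertices_iter cubG _ ady)[m m3 mv].
  by exists (Ordinal m3); apply/eqP.
apply: triple_for => //; first exact: n_gt0.
  by move=> l s [[]].
move=> l s ln sl [hs us hk [s7 s6] ms].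
have nb k' v := @input_nbr s k' v hs.
set d := iter l f (i, y) in s6 s7.
have ab : d.1 \in rot G d.2 by rewrite -rot_sym; exact: adj_iter_face_next.
have [nx0 nx1 nx2] := next_nbr cubG d.2; have [n01 n02 n12] := nbr_neq cubG d.2.
rewrite /= /upd /= s6 s7 !nb // !val_eqE.
pose s1 := set_iarr s 3 d.1 1.
rewrite -/s1.
have -> : (if nbr G 0 d.2 == d.1 then set_ireg s1 8 (nbr G 1 d.2) else
    if nbr G 1 d.2 == d.1 then set_ireg s1 8 (nbr G 2 d.2) else
    set_ireg s1 8 (nbr G 0 d.2)) = set_ireg s1 8 (next (rot G d.2) d.1).
  move: ab; rewrite rot_nbrE // => /or3P[] /eqP ->; rewrite ?nx0 ?nx1 ?nx2 ?eqxx //.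
    by rewrite (negbTE n01).
  by rewrite (negbTE n02) (negbTE n12).
split; first exact: sl.
split=> // v.
by rewrite (exists_ltnS _ ln) /= /upd /= ms val_eqE eq_sym orbC; case: (d.1 == v).
Qed.

Definition bary_at s v : Prop :=
  [/\ rarr s 2 v = bary G g v (nbr G 0 v), rarr s 3 v = bary G g v (nbr G 1 v)
    & rarr s 4 v = bary G g v (nbr G 2 v)].

Definition holds_bary s : Prop := forall v, bary_at s v.

Lemma bary_triple :
  triple n (fun s => [/\ holds_input s, marked s & unvisited s]) bary_prog
    (fun s => [/\ holds_input s, marked s, unvisited s & holds_bary s]).
Proof.
pose J l s := [/\ holds_input s, marked s, unvisited s
  & forall v, (v < l)%N -> bary_at s v].
apply: (triple_conseq (P' := J 0%N) (Q' := J (1 * n)%N)).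
- by move=> s [hs ms us]; split.
- by move=> s [hs ms us bs]; split=> // v; apply: bs; rewrite mul1n.
apply: triple_for => //; first exact: n_gt0.
  by move=> l s [[]].
move=> l s ln sl [hs ms us bs]; rewrite mul1n in ln; pose v := Ordinal ln.
have nbv k : (k < 3)%N -> iarr s k l = nbr G k v by exact: (@input_nbr s k v).
split; first exact: sl.
split=> // w wl.
have side_sl k1 k2 : (k1 < 3)%N -> (k2 < 3)%N ->
    (rarr s 0 (iarr s k1 l) - rarr s 0 l) * (rarr s 1 (iarr s k2 l) - rarr s 1 l)
    - (rarr s 1 (iarr s k1 l) - rarr s 1 l) * (rarr s 0 (iarr s k2 l) - rarr s 0 l)
    = cross (g (nbr G k1 v) - g v) (g (nbr G k2 v) - g v).
  move=> k13 k23; rewrite !nbv //.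
  exact: (@reval_side s (ICst v) (ICst (nbr G k1 v)) (ICst (nbr G k2 v))).
have [b0 b1 b2] := bary_nbr g cubG v.
rewrite /bary_at /= sl /upd /= !side_sl // -b0 -b1 -b2 ?eqxx.
case: eqP => [wE|/eqP nwl]; last by apply: bs; rewrite ltn_neqAle nwl.
by rewrite (_ : w = v) //; apply: val_inj.
Qed.

(** * The search for the scales *)

Definition holds_data s : Prop := [/\ holds_input s, marked s & holds_bary s].

Lemma rarr_bary s k v : holds_bary s -> (k < 3)%N ->
  rarr s (2 + k) v = bary G g v (nbr G k v).
Proof. by move=> /(_ v)[b0 b1 b2]; case: k => [|[|[|]]]. Qed.

Lemma run_read_bary s e1 e2 u v : holds_data s ->
  ieval s e1 = v -> ieval s e2 = u -> u \in rot G v ->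
  run (read_bary e1 e2) s = set_rreg s 0 (bary G g v u).
Proof.
move=> [hs _ bs] /= -> -> uv; have [b0 b1 b2] := bs v.
rewrite !(input_nbr _ hs) // !val_eqE b0 b1 b2.
have [n01 n02 n12] := nbr_neq cubG v.
move: uv; rewrite rot_nbrE // => /or3P[] /eqP ->; rewrite ?eqxx //.
  by rewrite (negbTE n01).
by rewrite (negbTE n02) (negbTE n12).
Qed.

(** The criterion of [weighted_barycenterP]: the products [sc i * bary G g i j] form an equilibrium
    stress, positive at internal vertices. *)
Definition stress (sc : 'I_n -> R) : Prop :=
  [/\ forall i, ~~ ext i -> 0 < sc i,
      forall i j, ~~ ext i -> j \in rot G i -> 0 < bary G g i j
    & forall i j, ~~ ext i -> ~~ ext j -> j \in rot G i ->
        sc i * bary G g i j = sc j * bary G g j i].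

(* [c] counts the pairs (vertex of the queue [q], edge at it) examined so far;
   the vertices [v] with [c <= 3 * index v q + 2] have an edge left. *)
Definition search_ok (om : 'I_n -> R) (q : seq 'I_n) (c : nat) (sc : 'I_n -> R) : Prop :=
  [/\ forall v, v \in q -> 0 < sc v,
      forall v k, v \in q -> (k < 3)%N -> (3 * index v q + k < c)%N ->
        ~~ ext (nbr G k v) ->
        nbr G k v \in q /\ sc (nbr G k v) / om (nbr G k v) = sc v / om v
    & forall u v, u \in q -> v \in q ->
        (c <= 3 * index u q + 2)%N -> (c <= 3 * index v q + 2)%N ->
        sc u / om u = sc v / om v].

(** The counter [c] encodes the pair of [u] and [k], the only one that becomes examined. *)
Lemma search_ok_step om q u k sc (c := (3 * index u q + k)%N) :
  u \in q -> (k < 3)%N -> search_ok om q c sc ->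
  (~~ ext (nbr G k u) -> nbr G k u \in q /\ sc (nbr G k u) / om (nbr G k u) = sc u / om u) ->
  search_ok om q c.+1 sc.
Proof.
move=> uq k3 [pos done todo] new.
split; [exact: pos | move=> v l vq l3 lc | move=> v w vq wq vc wc].
  have [lc'|ge] := ltnP (3 * index v q + l) c; first exact: done.
  have iv : index v q = index u q by rewrite /c in lc ge; lia.
  have -> : l = k by rewrite /c in lc ge; lia.
  have -> : v = u by rewrite -[v](nth_index u vq) iv nth_index.
  exact: new.
by apply: todo => //; lia.
Qed.

(** The new vertex is last in the queue, so none of its edges counts as examined; it only has to
    share the ratio of the pending vertices. *)
Lemma search_ok_push om q c sc sc' v :
  v \notin q -> (c <= 3 * size q)%N -> (forall u, u != v -> sc' u = sc u) -> 0 < sc' v ->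
  (forall u, u \in q -> (c <= 3 * index u q + 2)%N -> sc' v / om v = sc u / om u) ->
  search_ok om q c sc -> search_ok om (rcons q v) c sc'.
Proof.
move=> vq cq same pos_v new [pos done todo].
have old u : u \in q -> sc' u = sc u.
  by move=> uq; apply: same; apply: contraNneq vq => <-.
have idx u : u \in q -> index u (rcons q v) = index u q.
  by move=> uq; rewrite -cats1 index_cat uq.
have idv : index v (rcons q v) = size q.
  by rewrite -cats1 index_cat (negbTE vq) /= eqxx addn0.
split.
- by move=> u; rewrite mem_rcons inE => /orP[/eqP ->|uq] //; rewrite old ?pos.
- move=> u k; rewrite mem_rcons inE => /orP[/eqP ->|uq] k3; first by rewrite idv; lia.
  rewrite idx // => kc ek; have [nq E] := done u k uq k3 kc ek.
  by rewrite mem_rcons inE nq orbT !old.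
- move=> u w; rewrite !mem_rcons !inE => /orP[/eqP ->|uq] /orP[/eqP ->|wq] //.
  + by move=> _; rewrite idx // => wc; rewrite (old w) //; exact: new.
  + by rewrite idx // => uc _; rewrite (old u) //; apply/esym; exact: new.
  + by rewrite !idx // !old //; exact: todo.
Qed.

(** If the neighbour is still pending, it has the common ratio of pending vertices; otherwise its
    own edge back to [u] was examined earlier. *)
Lemma search_ok_done_edge om q c sc u k :
  u \in q -> (k < 3)%N -> c = (3 * index u q + k)%N -> ~~ ext u ->
  nbr G k u \in q -> search_ok om q c sc ->
  sc (nbr G k u) / om (nbr G k u) = sc u / om u.
Proof.
move=> uq k3 cE eu vq [pos done todo]; set v := nbr G k u in vq *.
have [vc|vc] := leqP c (3 * index v q + 2).
  by apply: todo vq uq _ _; lia.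
have uv : u \in rot G v by rewrite -rot_sym nbr_in_rot.
have [l l3 ul] : exists2 l, (l < 3)%N & u = nbr G l v.
  by move: uv; rewrite rot_nbrE // => /or3P[] /eqP; [exists 0%N | exists 1%N | exists 2%N].
rewrite ul in eu; have [|_] := done v l vq l3 _ eu; first by lia.
by rewrite -ul.
Qed.

Definition queue (q : seq 'I_n) s : Prop :=
  [/\ uniq q, all (predC (ext)) q, ireg s 11 = size q,
      forall v, iarr s 5 v = (v \in q)
    & forall v, v \in q -> iarr s 4 (index v q) = v].

(** The scales are compared with every stress. If there is none, nothing is claimed about them, and
    the final test rejects. *)
Definition search (q : seq 'I_n) (c : nat) s : Prop :=
  [/\ holds_data s, queue q s
    & forall om, stress om -> search_ok om q c (fun v => rarr s 5 v)].

Lemma queue_push q s v : queue q s -> v \notin q -> ~~ ext v -> ireg s 9 = v ->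
  queue (rcons q v) (run push_prog s).
Proof.
move=> [uq eq s11 vis at_q] vq ev s9; split.
- by rewrite rcons_uniq vq.
- by rewrite all_rcons eq andbT.
- by rewrite /= /upd /= s11 size_rcons addn1.
- move=> w; rewrite /= /upd /= s9 val_eqE mem_rcons inE vis.
  by case: (w == v).
- move=> w; rewrite mem_rcons inE /= /upd /= s9 s11 -cats1 index_cat => wq.
  case: (boolP (w \in q)) wq => [wq _|_].
    by rewrite ltn_eqF ?index_mem // at_q.
  by rewrite orbF => /eqP ->; rewrite /= eqxx addn0 eqxx.
Qed.

Lemma search_visit q s u k : (k < 3)%N -> u \in q -> ireg s 8 = u ->
  search q (3 * index u q + k) s ->
  exists q', [/\ search q' (3 * index u q' + k.+1) (run (visit_prog k) s), u \in q',
    index u q' = index u q, {subset q <= q'}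
  & forall x, x \in [:: 1; 8; 10; 12]%N -> ireg (run (visit_prog k) s) x = ireg s x].
Proof.
move=> k3 uq s8 [[hs ms bs] qs ok]; have [uniq_q int_q s11 vis at_q] := qs.
have eu : ~~ ext u by have /allP/(_ _ uq) := int_q.
set v := nbr G k u; pose s1 := set_ireg s 9 v.
have runE : run (visit_prog k) s =
    if ~~ ext v && (v \notin q) then
      run push_prog (set_rarr (set_rreg s1 0 (bary G g v u)) 5 v
        (rarr s 5 u * bary G g u v / bary G g v u)) else s1.
  have -> : run (visit_prog k) s =
      if (iarr s 3 (iarr s k (ireg s 8)) == 0%N) && (iarr s 5 (iarr s k (ireg s 8)) == 0%N)
      then run push_prog (run (RPut 5 (IReg 9)
             (RDiv (RMul (RGet 5 (IReg 8)) (RGet (2 + k) (IReg 8))) (RReg 0)))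
             (run (read_bary (IReg 9) (IReg 8)) (set_ireg s 9 (iarr s k (ireg s 8)))))
      else set_ireg s 9 (iarr s k (ireg s 8)) by [].
  rewrite s8 (input_nbr _ hs) // -/v ms vis !eqb0.
  case: ifP => // _; rewrite (@run_read_bary _ _ _ u v) //; last first.
    by rewrite -rot_sym nbr_in_rot.
  congr (run push_prog (set_rarr _ _ _ _)).
  rewrite /= /upd /= s8; congr (_ * _ / _).
  exact: rarr_bary.
rewrite runE; case: ifPn => [/andP[ev vq]|skip].
  set s2 := set_rarr _ _ _ _.
  have iu : index u (rcons q v) = index u q by rewrite -cats1 index_cat uq.
  have uq' : u \in rcons q v by rewrite mem_rcons inE uq orbT.
  exists (rcons q v); split=> //.
  - split=> [||om som]; first by [].
      exact: queue_push.
    have [om0 b0 omE] := som; have vu : v \in rot G u by rewrite nbr_in_rot.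
    have uv : u \in rot G v by rewrite -rot_sym.
    have [pos done todo] := ok om som.
    have sv : rarr (run push_prog s2) 5 v = rarr s 5 u * bary G g u v / bary G g v u.
      by rewrite /= /upd /= eqxx.
    (* Both the new scale and [om] satisfy the edge equation for [u] and [v], so the ratio carries
       over. *)
    have ru : rarr (run push_prog s2) 5 v / om v = rarr s 5 u / om u.
      have [nu nv] := (lt0r_neq0 (om0 _ eu), lt0r_neq0 (om0 _ ev)).
      have nb := lt0r_neq0 (b0 _ _ ev uv).
      have bE : bary G g u v = om v * bary G g v u / om u.
        by apply: (mulfI nu); rewrite omE // [RHS]mulrC divfK.
      by rewrite sv bE; field; rewrite nu nv nb.
    have pv : 0 < rarr (run push_prog s2) 5 v.
      rewrite sv; apply: divr_gt0; last exact: b0.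
      by apply: mulr_gt0; [exact: pos | exact: b0].
    have su w : w != v -> rarr (run push_prog s2) 5 w = rarr s 5 w.
      by move=> wv; rewrite /= /upd /= val_eqE (negbTE wv).
    have c3 : (3 * index u q + k <= 3 * size q)%N.
      have : (3 * (index u q).+1 <= 3 * size q)%N by rewrite leq_mul2l index_mem.
      by move: k3; clear; lia.
    have uv' : u != v by apply: contraNneq vq => <-.
    rewrite addnS; apply: search_ok_step => //.
      rewrite iu; apply: search_ok_push vq _ su _ _ (ok om som) => /=.
      + exact: c3.
      + exact: pv.
      + by move=> w wq wc; rewrite [LHS]ru; apply: todo uq wq _ wc; lia.
    by move=> _; split; [rewrite mem_rcons mem_head | rewrite ru (su u)].
  - by move=> w wq; rewrite mem_rcons inE wq orbT.
  - by move=> x; rewrite !inE => /or4P[] /eqP ->.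
exists q; split=> //.
- split=> // om som; rewrite addnS; apply: search_ok_step => //; first exact: ok.
  move=> ev; rewrite ev negbK /= in skip; split=> //.
  exact: (search_ok_done_edge uq k3 erefl eu skip (ok om som)).
- by move=> x; rewrite !inE => /or4P[] /eqP ->.
Qed.

Lemma search_examine q s h : search q (3 * h) s -> ireg s 10 = h -> (h < size q)%N ->
  exists q', [/\ search q' (3 * h.+1) (run examine_prog s), {subset q <= q'},
    (h < size q')%N, ireg (run examine_prog s) 10 = h.+1
  & ireg (run examine_prog s) 12 = ireg s 12 /\ ireg (run examine_prog s) 1 = ireg s 1].
Proof.
move=> sq s10 hq; have [_ [uniq_q _ _ _ at_q] _] := sq.
pose u := nth (Ordinal n_gt0) q h.
have uq : u \in q by rewrite mem_nth.
have iu : index u q = h by rewrite index_uniq.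
pose s0 := set_ireg s 8 u.
have -> : run examine_prog s = run (ISet 10 (IAdd (IReg 10) (ICst 1)))
    (run (visit_prog 2) (run (visit_prog 1) (run (visit_prog 0) s0))).
  by rewrite /examine_prog /s0 -(at_q u uq) iu -s10.
have sq0 : search q (3 * index u q + 0) s0 by rewrite iu addn0; exact: sq.
have [//|q1 [sq1 uq1 iu1 sub1 keep1]] := search_visit (isT : (0 < 3)%N) uq _ sq0.
have [|q2 [sq2 uq2 iu2 sub2 keep2]] := search_visit (isT : (1 < 3)%N) uq1 _ sq1.
  by rewrite keep1.
have [|q3 [sq3 uq3 iu3 sub3 keep3]] := search_visit (isT : (2 < 3)%N) uq2 _ sq2.
  by rewrite keep2 // keep1.
have keep x : x \in [:: 1; 8; 10; 12]%N ->
    ireg (run (visit_prog 2) (run (visit_prog 1) (run (visit_prog 0) s0))) x = ireg s0 x.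
  by move=> xin; rewrite keep3 // keep2 // keep1.
have iu3' : index u q3 = h by rewrite iu3 iu2 iu1.
exists q3; move: (run (visit_prog 2) _) keep sq3 => s3 keep sq3.
rewrite iu3' in sq3; split.
- by rewrite mulnS addnC; exact: sq3.
- by move=> x /sub1/sub2/sub3.
- by rewrite -iu3' index_mem.
- by rewrite /= /upd /= keep // -s10 addn1.
- by rewrite /= /upd /= !keep.
Qed.

(** A root is tried only when the queue is exhausted, so no pending vertex constrains its scale. *)
Lemma search_start q s r : search q (3 * size q) s -> ireg s 12 = r ->
  exists q', [/\ search q' (3 * size q) (run start_prog s), {subset q <= q'},
    (size q <= size q')%N /\ ((n <= r)%N -> q' = q),
    forall v, v = r :> nat -> ~~ ext v -> v \in q'
  & [/\ ireg (run start_prog s) 10 = ireg s 10, ireg (run start_prog s) 12 = r.+1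
    & ireg (run start_prog s) 1 = ireg s 1]].
Proof.
move=> sq s12; have [[hs ms bs] qs ok] := sq; have [uniq_q int_q s11 vis at_q] := qs.
have s0 : ireg s 0 = n by case: hs.
pose s1 := run (ISet 9 (IReg 12) ;; RPut 5 (IReg 9) (RCst 1) ;; push_prog) s.
have runE : run start_prog s = run (ISet 12 (IAdd (IReg 12) (ICst 1)))
    (if (r < n)%N && ((iarr s 3 r == 0%N) && (iarr s 5 r == 0%N)) then s1 else s).
  have -> : (r < n)%N = (ireg s 12 + 1 <= ireg s 0)%N by rewrite s12 s0 addn1.
  by rewrite -s12.
rewrite {}runE; case: ifPn => [/andP[rn]|skip].
  pose v : 'I_n := Ordinal rn.
  rewrite (ms v) (vis v) !eqb0 => /andP[ev vq].
  exists (rcons q v); split.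
  - split; first by [].
      have := @queue_push q (run (ISet 9 (IReg 12) ;; RPut 5 (IReg 9) (RCst 1)) s) v qs vq ev.
      exact.
    move=> om som; have [pos done todo] := ok om som.
    apply: search_ok_push vq _ _ _ _ (ok om som) => //.
    + by move=> w wv; rewrite /= /upd /= s12 (val_eqE w v) (negbTE wv).
    + by rewrite /= /upd /= s12 eqxx ltr01.
    + move=> w wq wc; suff : (index w q < size q)%N by lia.
      by rewrite index_mem.
  - by move=> w wq; rewrite mem_rcons inE wq orbT.
  - by rewrite size_rcons; split=> //; lia.
  - by move=> w wr _; rewrite (_ : w = v) ?mem_rcons ?mem_head //; apply: val_inj.
  - by rewrite /= /upd /= s12 addn1.
exists q; split=> //.
- move=> v vr ev; move: skip; rewrite -vr ltn_ord ms vis (negbTE ev) /=.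
  by rewrite eqb0 negbK.
- by rewrite /= /upd /= s12 addn1.
Qed.

Definition scaled s : Prop := forall om, stress om -> stress (fun v => rarr s 5 v).

(** After [2 * n] rounds at most [n] examined a vertex, so all roots were tried and every internal
    vertex is queued; equal ratios across all edges then make the scales a stress if one exists. *)
Lemma scale_triple :
  triple n (fun s => [/\ holds_input s, marked s, unvisited s & holds_bary s])
    scale_prog (fun s => holds_data s /\ scaled s).
Proof.
pose J k s := exists q h r, [/\ search q (3 * h) s, ireg s 10 = h /\ ireg s 12 = r,
  (h <= size q)%N /\ (h + r = k)%N, (n < r)%N -> h = size q
  & forall v, (v < r)%N -> ~~ ext v -> v \in q].
have loop : triple n (J 0%N)
   (For 2 (If (ILe (IAdd (IReg 10) (ICst 1)) (IReg 11)) examine_prog start_prog))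
   (J (2 * n)%N).
  apply: triple_for => //; first exact: n_gt0.
    by move=> k s [q [h [r [[[[]]]]]]].
  move=> k s kn sk [q [h [r [sq [s10 s12] [hq hrk] nr vr]]]].
  have s11 : ireg s 11 = size q by have [_ []] := sq.
  have -> : run (If (ILe (IAdd (IReg 10) (ICst 1)) (IReg 11)) examine_prog start_prog) s =
      if (h < size q)%N then run examine_prog s else run start_prog s.
    have -> : (h < size q)%N = (ireg s 10 + 1 <= ireg s 11)%N by rewrite s10 s11 addn1.
    by [].
  case: ltnP => [lt_hq|ge_hq].
    have [q' [sq' sub hq' s10' [s12' s1']]] := search_examine sq s10 lt_hq.
    split; first by rewrite s1'.
    exists q', h.+1, r; split=> //.
    - by rewrite s12'.
    - by split=> //; lia.
    - by move=> /nr hE; rewrite hE ltnn in lt_hq.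
    - by move=> v lt_vr ev; apply: sub; exact: vr.
  have hE : h = size q by lia.
  rewrite hE in sq; have [q' [sq' sub [qq' qE] new [s10' s12' s1']]] := search_start sq s12.
  split; first by rewrite s1'.
  exists q', h, r.+1; split=> //.
  - by rewrite hE.
  - by rewrite s10'.
  - by split; lia.
  - by rewrite ltnS => /qE ->.
  - move=> v; rewrite ltnS leq_eqVlt => /orP[/eqP vr' ev|lt_vr ev]; first exact: new.
    by apply: sub; exact: vr.
apply: (triple_seq (Q := fun s => [/\ holds_input s, marked s, unvisited s, holds_bary s &
    ireg s 10 = 0%N])).
  by apply: triple_loop_free n_gt0 _ _ => // s [].
apply: (triple_seq (Q := fun s => [/\ holds_input s, marked s, unvisited s, holds_bary s &
    ireg s 10 = 0%N /\ ireg s 11 = 0%N])).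
  by apply: triple_loop_free n_gt0 _ _ => // s [].
apply: (triple_seq (Q := J 0%N)).
  apply: triple_loop_free n_gt0 _ _ => // s [hs ms us bs [s10 s11]].
  by exists [::], 0%N, 0%N; split=> //; split.
apply: triple_conseq (fun s => id) _ loop.
move=> s [q [h [r [[data [uniq_q int_q _ _ _] ok] _ [hq hr] nr vr]]]]; split=> // om som.
have qn : (size q <= n)%N by rewrite -(card_uniqP uniq_q) -[leqRHS]card_ord max_card.
have rn : (n <= r)%N by lia.
(* If [r = n] then [h = n], which bounds the size of the queue; if [r > n], a round was spent on a
   root beyond the last vertex, with the queue exhausted. *)
have hE : h = size q.
  have [/nr //|rn'] := ltnP n r.
  by lia.
have all_q v : ~~ ext v -> v \in q by move=> ev; apply: vr => //; exact: leq_trans rn.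
have [pos done _] := ok om som; have [om0 b0 omE] := som.
split; [by move=> v /all_q; exact: pos | exact: b0 |].
move=> v w ev ew wv.
have [k k3 wE] : exists2 k, (k < 3)%N & w = nbr G k v.
  by move: wv; rewrite rot_nbrE // => /or3P[] /eqP; [exists 0%N | exists 1%N | exists 2%N].
have [||_] := done v k (all_q _ ev) k3; rewrite -?wE //.
  have : (index v q < size q)%N by rewrite index_mem all_q.
  by lia.
(* Clearing denominators in the equal ratios transfers the edge equation from [om] to the scales. *)
move=> /(congr1 ( *%R^~ (om w * om v))).
have [nw nv] := (lt0r_neq0 (om0 _ ew), lt0r_neq0 (om0 _ ev)).
rewrite mulrA divfK // (mulrC (om w)) mulrA divfK // => E.
by apply: (mulfI nv); rewrite mulrCA omE // mulrA -E -mulrA mulrCA.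
Qed.

(** * The final test *)

Definition edge_ok (f : nat -> R) (v : 'I_n) (k : nat) : bool :=
  let u := nbr G k v in (0 < bary G g v u) &&
  (ext u || (f v * bary G g v u == f u * bary G g u v)).

Definition vertex_ok (f : nat -> R) (v : 'I_n) : bool :=
  ext v || [&& 0 < f v, edge_ok f v 0, edge_ok f v 1 & edge_ok f v 2].

Lemma run_check_edge s v k (s' := run (check_edge k) s) :
  (k < 3)%N -> holds_data s -> ireg s 1 = v ->
  [/\ holds_data s', rarr s' = rarr s, ireg s' 1 = v
    & ireg s' 13 = (edge_ok (rarr s 5) v k * ireg s 13)%N].
Proof.
move=> k3 data s1; have [hs ms bs] := data; set u := nbr G k v.
have -> : s' = let s2 := set_ireg (if bary G g v u <= 0 then set_ireg s 13 0 else s) 9 u in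
    if ext u then s2 else
    let s3 := set_rreg s2 0 (bary G g u v) in
    if rarr s 5 v * bary G g v u == rarr s 5 u * bary G g u v then s3 else set_ireg s3 13 0.
  pose s4 := if bary G g v u <= 0 then set_ireg s 13 0 else s.
  have E4 : run (If (RLe (RGet (2 + k) (IReg 1)) (RCst 0)) (ISet 13 (ICst 0)) Skip) s = s4.
    by rewrite [run _ _]/= s1 (rarr_bary v bs k3).
  have [d4 r4 i4 a4] : [/\ holds_data s4, rarr s4 = rarr s, ireg s4 1 = v & iarr s4 = iarr s].
    by rewrite /s4; case: ifP.
  have [hs4 ms4 bs4] := d4.
  have -> : s' = let s5 := run (If (RLe (RGet (2 + k) (IReg 1)) (RCst 0))
        (ISet 13 (ICst 0)) Skip) s in
      let s6 := set_ireg s5 9 (iarr s5 k (ireg s5 1)) in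
      if iarr s5 3 (iarr s5 k (ireg s5 1)) == 0%N then
        run (If (REq (RMul (RGet 5 (IReg 1)) (RGet (2 + k) (IReg 1)))
                     (RMul (RGet 5 (IReg 9)) (RReg 0))) Skip (ISet 13 (ICst 0)))
            (run (read_bary (IReg 9) (IReg 1)) s6)
      else s6 by [].
  rewrite E4; cbv zeta; rewrite i4 (input_nbr v hs4 k3) -/u -/s4.
  rewrite (ms4 u) eqb0; case: (ext u) => //.
  rewrite [~~ false]/= -/u.
  have rb e1 e2 s0 : holds_data s0 -> ieval s0 e1 = u -> ieval s0 e2 = v ->
      run (read_bary e1 e2) s0 = set_rreg s0 0 (bary G g u v).
    by move=> d0 ? ?; apply: run_read_bary d0 _ _ _ => //; rewrite -rot_sym nbr_in_rot.
  rewrite rb //.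
  by rewrite /= /upd /= i4 (rarr_bary v bs4 k3) r4.
rewrite /edge_ok -/u [0 < _]ltNge.
case: (_ <= 0) => /=; case: (ext u) => /=; try case: eqP => _;
  by split=> //=; rewrite /upd /= ?mul1n ?mul0n.
Qed.

Lemma check_triple (yes : Prop) f :
  (yes <-> [forall v, vertex_ok f v]) ->
  triple n (fun s => holds_data s /\ rarr s 5 = f) check_prog (fun s => answers_yes s <-> yes).
Proof.
move=> yesE.
pose J k s := [/\ holds_data s, rarr s 5 = f
  & ireg s 13 = ~~ [exists v : 'I_n, (v < k)%N && ~~ vertex_ok f v]].
apply: (triple_seq (Q := J 0%N)).
  apply: triple_loop_free n_gt0 _ _ => // s [data fE].
  by split=> //; rewrite exists_lt0.
apply: (triple_seq (Q := J (1 * n)%N)); last first.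
  apply: triple_loop_free n_gt0 _ _ => // s [_ _ s13].
  rewrite yesE /answers_yes /= /upd /= s13 mul1n exists_ltn negb_exists.
  have -> : [forall v, ~~ ~~ vertex_ok f v] = [forall v, vertex_ok f v].
    by apply: eq_forallb => v; rewrite negbK.
  by case: [forall _, _].
apply: triple_for => //; first exact: n_gt0.
  by move=> k s [[[]]].
move=> k s kn sk [data fE s13]; rewrite mul1n in kn; pose v : 'I_n := Ordinal kn.
have [hs ms bs] := data.
pose s1 := if f v <= 0 then set_ireg s 13 0 else s.
have -> : run (If (IEq (IGet 3 (IReg 1)) (ICst 0))
            (If (RLe (RGet 5 (IReg 1)) (RCst 0)) (ISet 13 (ICst 0)) Skip ;;
             check_edge 0 ;; check_edge 1 ;; check_edge 2) Skip) s =
    if ext v then s else run (check_edge 2) (run (check_edge 1) (run (check_edge 0) s1)).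
  have -> : ext v = ~~ beval s (IEq (IGet 3 (IReg 1)) (ICst 0)).
    by rewrite /= sk (ms v) eqb0 negbK.
  have vk : nat_of_ord v = ireg s 1 by rewrite sk.
  by rewrite if_neg /s1 -fE vk.
rewrite /J (exists_ltnS _ kn) -/v negb_or (negbK (vertex_ok f v)) [vertex_ok f v]/vertex_ok.
case: ifPn => [ev|nev]; first by split=> //; split=> //; rewrite s13 andbT.
have [d1 f1 i1 e1] : [/\ holds_data s1, rarr s1 5 = f, ireg s1 1 = v
    & ireg s1 13 = ((0 < f v)%R * ireg s 13)%N].
  by rewrite /s1 ltNge; case: ifP => //= _; rewrite ?mul1n.
have [d2 f2 i2 e2] := run_check_edge (isT : (0 < 3)%N) d1 i1.
have [d3 f3 i3 e3] := run_check_edge (isT : (1 < 3)%N) d2 i2.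
have [d4 f4 i4 e4] := run_check_edge (isT : (2 < 3)%N) d3 i3.
split; first exact: i4.
split; [exact: d4 | by rewrite f4 f3 f2 |].
rewrite e4 e3 e2 e1 f3 f2 f1 s13 !mulnb /=; congr nat_of_bool.
move: (edge_ok f v 0) (edge_ok f v 1) (edge_ok f v 2) (0 < f v) [exists _, _].
by do 5!case.
Qed.

Lemma all_vertices_okP (f : nat -> R) :
  reflect (stress (fun v => f v)) [forall v, vertex_ok f v].
Proof.
apply: (iffP forallP) => [ok|[f0 b0 fE] v].
  have edgeP u v : ~~ ext u -> v \in rot G u -> 0 < bary G g u v /\
      (~~ ext v -> f u * bary G g u v = f v * bary G g v u).
    move=> eu; have := ok u; rewrite /vertex_ok (negbTE eu) /= => /and4P[_ o0 o1 o2].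
    have key k : edge_ok f u k -> 0 < bary G g u (nbr G k u) /\ (~~ ext (nbr G k u) ->
        f u * bary G g u (nbr G k u) = f (nbr G k u) * bary G g (nbr G k u) u).
      by move=> /andP[bk /orP[-> //|/eqP ->]].
    by rewrite rot_nbrE // => /or3P[] /eqP ->; exact: key.
  split=> [v ev|v w ev wv|v w ev ew wv].
  - by have := ok v; rewrite /vertex_ok (negbTE ev) /= => /and4P[].
  - by have [] := edgeP v w ev wv.
  - by have [_ /(_ ew)] := edgeP v w ev wv.
rewrite /vertex_ok; case: (boolP (ext v)) => //= ev.
have edge k : (k < 3)%N -> edge_ok f v k.
  move=> k3; have kv := nbr_in_rot cubG v k3.
  rewrite /edge_ok b0 //=; case: (boolP (ext _)) => //= ek.
  by rewrite fE.
by rewrite f0 //= !edge.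
Qed.

Lemma recognition_triple :
  triple n (fun s => holds_input s /\ unmarked s) recognition_prog
    (fun s => answers_yes s <-> weighted_barycenter_drawing G g).
Proof.
have extP i : ext i <-> on_hull g i by split=> /asboolP.
have bary_stress := weighted_barycenterP cubG Gplanar extP.
apply: triple_seq leftmost_triple _; apply: triple_seq dart_triple _.
apply: triple_seq walk_triple _; apply: triple_seq bary_triple _.
apply: triple_seq scale_triple _.
apply: (triple_conseq (P' := fun s => exists f : nat -> R,
  (stress (fun v => f v) <-> weighted_barycenter_drawing G g) /\
  holds_data s /\ rarr s 5 = f) _ (fun s => id)).
  move=> s [data sc]; exists (rarr s 5); split=> //.
  (* Scales that pass the test are themselves a witness; conversely any stress [om] guarantees that
     the computed scales form one. *)
  by split=> [st|/bary_stress[om /sc]//]; apply/bary_stress; exists (fun v => rarr s 5 v).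
apply: triple_exists => f s [fE]; apply: check_triple.
by rewrite -fE; split=> /all_vertices_okP.
Qed.

Lemma input_ok : holds_input (input G g) /\ unmarked (input G g).
Proof.
split.
  split=> // v; rewrite /= !valK /nbr //.
  by split; rewrite (nth_map v) // cubG.
(* Arrays 3 and 5 would hold entries 3 and 5 of rotations of length three, hence start with the
   default 0. *)
by move=> v; rewrite /= !valK !nth_default // size_map cubG.
Qed.

End Recognition.

Theorem corollary2 :
  exists (p : prog) (c : nat),
    forall (R : realType) (n : nat) (G : plane_graph n) (g : 'I_n -> 'rV[R]_2),
      cubic G ->
      triconnected G ->
      straight_line_planar_drawing G g ->
      hull_vertices_form_face G g ->
      exists (t : nat) (s : state R),
        [/\ exec p (input G g) t s,
            (t <= c * n)%N
          & answers_yes s <-> weighted_barycenter_drawing G g].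
Proof.
exists recognition_prog, (cost_factor recognition_prog) => R n G g cubG G3 Gplanar Gface.
exact: recognition_triple cubG G3 Gplanar Gface _ (input_ok g cubG).
Qed.
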